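(* Consider the infinite-frame cancel-on-completion system. Suppose that the component sizes have finite second moments, i.e. $\mathbb E[\xi^{(j)}_1]^2<\infty$ for every $j$, and that the following non-triviality assumption holds: there exists a class $j$ with $k_j<d_j$ and joint distribution $F_j$ of the component sizes such that (i) $\mathbb P\{\max_i\xi^{(j)}_i-\xi^{(j)}_{i_1}>0\}>0$, where $\xi^{(j)}_{i_1}$ is the $k_j$-th smallest among the component sizes $\xi^{(j)}_i$; and (ii) $\mathbb P\{\sum_i\mathbf 1(\xi^{(j)}_i=0)\ge k_j\}<1$. Then there exist $\bar C>0$ and $\bar n$ such that, uniformly in $n\ge\bar n$ and $\lambda^n$ such that the process $x^n(\cdot)$ is stable, $$\mathbb E\,\Phi_1(\mathring x^n(\infty))\le\bar C .$$
   Context: Model. There are $n$ identical servers working at unit rate in FCFS order, and a finite set of job classes $j$. Jobs arrive as a Poisson process of rate $\lambda^n n$; an arriving job is of class $j$ with probability $\pi^n_j\ge0$, $\sum_j\pi^n_j=1$. Class $j$ has integers $1\le k_j\le d_j$ and an exchangeable distribution $F_j$ on $\mathbb R_+^{d_j}$. A class $j$ job selects $d_j$ servers uniformly at random without replacement and places on them components with sizes $(\xi^{(j)}_1,\ldots,\xi^{(j)}_{d_j})\sim F_j$, drawn independently of the past. As soon as $k_j$ components complete service, the unfinished service of the other $d_j-k_j$ is cancelled. In terms of workloads (actual unfinished work of a server): if the selected servers have workloads $W_1,\dots,W_{d_j}$ just before the arrival and $T$ is the $k_j$-th smallest of $W_i+\xi^{(j)}_i$, then the workload of selected server $i$ becomes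 $\max\{W_i,\min\{W_i+\xi^{(j)}_i,T\}\}$ (infinite-frame system: no truncation). Between arrivals each positive workload decreases at rate 1 and zero workloads stay at 0. $W^n(t)=(W_1^n(t),\dots,W_n^n(t))\in\mathbb R_+^n$ is the resulting Markov process; $x^n_w(t)=\frac1n\sum_i\mathbf 1\{W^n_i(t)>w\}$, $w\ge0$, and $x^n(t)=(x^n_w(t))_{w\ge0}$. Stability of $W^n(\cdot)$ (equivalently of $x^n(\cdot)$) means positive Harris recurrence, i.e. the empty state $(0,\ldots,0)$ is reached from any state with probability 1 and the expected return time to it is finite; $W^n(\infty)$, $x^n(\infty)$ denote stationary versions. For a complementary distribution function $y=(y_u,u\in\mathbb R)$ with finite mean $\bar y$, $\mathring y_u=y_{u+\bar y}$ is its centered version and $\Phi_1(y)=\int_{-\infty}^\infty|u-\bar y|\,d[-y_u]$; $\mathring x^n(\infty)$ is the centered version of $x^n(\infty)$ (where $x^n_w=1$ for $w<0$). Thus $\Phi_1(\mathring x^n(\infty))=\frac1n\sum_{i=1}^n\big|W^n_i(\infty)-\frac1n\sum_{l=1}^nW^n_l(\infty)\big|$. Standing assumptions: the set of classes and $k_j,d_j,F_j$ do not depend on $n$; $\pi^n_j\to\pi_j$ as $n\to\infty$ for all $j$; $0<\mathbb E\xi^{(j)}_1<\infty$ for all $j$; there exists a class $j$ with $\mathbb P\{\sum_i \mathbf 1(\xi^{(j)}_i=0)\ge k_j\}<1$.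
   Formalization: The class j in the non-triviality assumption is additionally required to have positive limiting probability π_j > 0; if that class never occurs (π^n_j = 0) and all jobs have k = d = 1, the servers are independent queues and the bound fails near critical load. *)

(* Defs.v *)
From HB Require Import structures.
From mathcomp Require Export all_boot all_order all_algebra.
From mathcomp Require Export perm.
From mathcomp Require Export all_classical all_reals all_analysis.
From mathcomp Require Export measurable_realfun.

Set Implicit Arguments.
Unset Strict Implicit.
Unset Printing Implicit Defensive.

Import Order.TTheory GRing.Theory Num.Theory.
Import numFieldNormedType.Exports.

Local Open Scope classical_set_scope.
Local Open Scope ring_scope.

Section comp_df.
Context {R : realType}.

Record comp_df := CompDf {
  comp_df_fun :> R -> R ;
  comp_df_nonincreasing : {homo comp_df_fun : u v /~ u <= v} ;
  comp_df_right_continuous :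
    forall u, comp_df_fun v @[v --> u^'+] --> comp_df_fun u ;
  comp_df_at_minfty : comp_df_fun v @[v --> -oo] --> (1 : R) ;
  comp_df_at_pinfty : comp_df_fun v @[v --> +oo] --> (0 : R) }.

Definition opp_df (y : comp_df) (u : R) : R := - y u.

Lemma opp_df_nondecreasing (y : comp_df) : {homo opp_df y : u v / u <= v}.
Proof. by move=> u v uv; rewrite /opp_df lerN2 comp_df_nonincreasing. Qed.

Lemma opp_df_right_continuous (y : comp_df) : right_continuous (opp_df y).
Proof. by move=> u; apply: cvgN; exact: comp_df_right_continuous. Qed.

HB.instance Definition _ (y : comp_df) :=
  isCumulative.Build R _ R (opp_df y)
    (@opp_df_nondecreasing y) (@opp_df_right_continuous y).

(* the measure d[-y_u] *)
Definition df_measure (y : comp_df) := lebesgue_stieltjes_measure (opp_df y).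

Definition df_mean (y : comp_df) : R :=
  fine (\int[df_measure y]_u (u%:E))%E.

Lemma center_nonincreasing (y : comp_df) :
  {homo (fun u => y (u + df_mean y)) : u v /~ u <= v}.
Proof. by move=> u v uv; rewrite comp_df_nonincreasing// lerD2r. Qed.

Lemma center_right_continuous (y : comp_df) u :
  y (v + df_mean y) @[v --> u^'+] --> y (u + df_mean y).
Proof.
set m := df_mean y.
have shift : v + m @[v --> u^'+] --> (u + m)^'+.
  move=> A [e /= e0 eA]; exists e => // v /= uve uv.
  by apply: eA; rewrite /= ?ltrD2r// opprD addrACA subrr addr0.
by move=> A /comp_df_right_continuous/shift.
Qed.

Lemma center_at_minfty (y : comp_df) :
  y (v + df_mean y) @[v --> -oo] --> (1 : R).
Proof.
by move=> A /(@comp_df_at_minfty y) yA; exact: (cvg_addrr_Ny (df_mean y) yA).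
Qed.

Lemma center_at_pinfty (y : comp_df) :
  y (v + df_mean y) @[v --> +oo] --> (0 : R).
Proof.
by move=> A /(@comp_df_at_pinfty y) yA; exact: (cvg_addrr (df_mean y) yA).
Qed.

Definition centered (y : comp_df) : comp_df :=
  CompDf (@center_nonincreasing y) (@center_right_continuous y)
    (@center_at_minfty y) (@center_at_pinfty y).

Definition Phi1 (y : comp_df) : \bar R :=
  (\int[df_measure y]_u (`|u - df_mean y|%:E))%E.

End comp_df.
Arguments comp_df R : clear implicits.

Section workload.
Context {R : realType}.
Variable n : nat.
Implicit Types w : n.-tuple R.

Definition nonneg w : Prop := forall i, 0 <= tnth w i.

Definition empty : n.-tuple R := [tuple 0 | i < n].

(* Workloads are nonnegative, so the case u < 0 only matters for n = 0, where it
   makes tail_fraction a complementary distribution function. *)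
Definition tail_fraction w (u : R) : R :=
  if u < 0 then 1 else n%:R^-1 * \sum_(i < n) (u < tnth w i)%R%:R.

Lemma tail_fraction_nonincreasing w : {homo tail_fraction w : u v /~ u <= v}.
Proof.
have le1 u : n%:R^-1 * \sum_(i < n) (u < tnth w i)%R%:R <= 1 :> R.
  have [n0|n0] := posnP n.
    by rewrite [X in X^-1](_ : _ = 0) ?invr0 ?mul0r// n0.
  rewrite ler_pdivrMl ?ltr0n// mulr1 [leRHS](_ : _ = \sum_(i < n) 1); last first.
    by rewrite sumr_const card_ord.
  by apply: ler_sum => i _; case: ltP.
move=> v u uv; rewrite /tail_fraction.
have [u0|u0] := ltP u 0; first by case: ltP.
rewrite ltNge (le_trans u0 uv)/= ler_wpM2l ?invr_ge0 ?ler0n//.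
apply: ler_sum => i _; case: (ltP v) => // vi.
by rewrite (le_lt_trans uv vi).
Qed.

Lemma tail_fraction_right_continuous w u :
  tail_fraction w v @[v --> u^'+] --> tail_fraction w u.
Proof.
apply: cvg_near_cst; have [u0|u0] := ltP u 0.
  near=> v; have v0 : v < 0 by near: v; exact: nbhs_right_lt.
  by rewrite /tail_fraction u0 v0.
have near_i : \forall v \near u^'+,
    forall i, (v < tnth w i) = (u < tnth w i).
  apply: filter_forall => i; have [ui|iu] := ltP u (tnth w i).
    by near=> v; near: v; exact: nbhs_right_lt.
  near=> v; have uv : u < v by near: v; exact: nbhs_right_gt.
  by apply/negbTE; rewrite -leNgt (le_trans iu)// ltW.
near=> v; have uv : u < v by near: v; exact: nbhs_right_gt.
rewrite /tail_fraction !ltNge u0 (le_trans u0 (ltW uv))/=; congr (_ * _).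
by apply: eq_bigr => i _; rewrite (near near_i v).
Unshelve. all: by end_near. Qed.

Lemma tail_fraction_at_minfty w : tail_fraction w v @[v --> -oo] --> (1 : R).
Proof.
apply: cvg_near_cst; near=> v.
have v0 : v < 0 by near: v; exact: nbhs_ninfty_lt.
by rewrite /tail_fraction v0.
Unshelve. all: by end_near. Qed.

Lemma tail_fraction_at_pinfty w : tail_fraction w v @[v --> +oo] --> (0 : R).
Proof.
have near_i : \forall v \near +oo, forall i, tnth w i <= v.
  by apply: filter_forall => i; apply: nbhs_pinfty_ge; exact: num_real.
apply: cvg_near_cst; near=> v; rewrite /tail_fraction.
have v0 : 0 <= v by near: v; exact: nbhs_pinfty_ge.
have vi i : tnth w i <= v by rewrite (near near_i v).
by rewrite ltNge v0/= big1 ?mulr0// => i _; rewrite ltNge vi.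
Unshelve. all: by end_near. Qed.

Definition occupancy w : comp_df R :=
  CompDf (@tail_fraction_nonincreasing w) (@tail_fraction_right_continuous w)
    (@tail_fraction_at_minfty w) (@tail_fraction_at_pinfty w).

(* Evolution for a time t without arrivals *)
Definition drain w (t : R) : n.-tuple R :=
  [tuple Num.max 0 (tnth w i - t) | i < n].

End workload.

(* the k-th smallest entry of s, for 1 <= k <= size s *)
Definition kth_smallest {R : realType} (k : nat) (s : seq R) : R :=
  nth 0 (sort <=%R s) k.-1.

(* Effect of an arriving job whose a-th component, of size xi_a, goes to the
   server s a and which completes with its k-th component. *)
Definition add_job {R : realType} {n d : nat} (k : nat)
    (s : {ffun 'I_d -> 'I_n}) (xi : d.-tuple R) (w : n.-tuple R) : n.-tuple R :=
  let T := kth_smallest k [tuple tnth w (s a) + tnth xi a | a < d] in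
  [tuple if [pick a | s a == i] is Some a
         then Num.max (tnth w i) (Num.min (tnth w i + tnth xi a) T)
         else tnth w i | i < n].

Definition exchangeable {R : realType} {d : nat}
    (F : probability (d.-tuple R) R) : Prop :=
  forall (s : {perm 'I_d}) (A : set (d.-tuple R)), measurable A ->
    F [set xi | A [tuple tnth xi (s a) | a < d]] = F A.

Section process.
Context {R : realType} {J : finType}.
Variables (k d : J -> nat) (F : forall j, probability ((d j).-tuple R) R).

(* The m-th job (m = 0, 1, ...) arrives gap m after the previous one (after time
   0 if m = 0) and is of class cls m; if that class is j, it goes to the
   servers sel m j with component sizes siz m j (the values sel m j', siz m j'
   for j' != cls m play no role, and their law is left unspecified).
   arrivals_law says that the gaps and the marks (class, servers, sizes) are all
   independent, the gaps being exponential with the given rate, the class having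
   law p and, given class j, the servers being uniform among the
   n (n - 1) ... (n - d_j + 1) injections and the sizes having law F_j. *)
Record arrivals (n : nat) (rate : R) (p : J -> R)
    (dO : measure_display) (O : measurableType dO) (P : probability O R) :=
  Arrivals {
    gap : nat -> O -> R ;
    cls : nat -> O -> J ;
    sel : nat -> forall j, O -> {ffun 'I_(d j) -> 'I_n} ;
    siz : nat -> forall j, O -> (d j).-tuple R ;
    gap_gt0 : forall m o, 0 < gap m o ;
    measurable_gap : forall m, measurable_fun setT (gap m) ;
    measurable_cls : forall m j, measurable [set o | cls m o = j] ;
    measurable_sel : forall m j s, measurable [set o | sel m j o = s] ;
    measurable_siz : forall m j, measurable_fun setT (siz m j) ;
    arrivals_law : forall (N : nat) (B : nat -> set R) (j : nat -> J)
        (s : forall m, {ffun 'I_(d (j m)) -> 'I_n})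
        (A : forall m, set ((d (j m)).-tuple R)),
      (forall m, measurable (B m)) -> (forall m, measurable (A m)) ->
      P [set o | forall m, (m < N)%N ->
           [/\ B m (gap m o), cls m o = j m, sel m (j m) o = s m
             & A m (siz m (j m) o)]] =
      (\prod_(m < N)
        (exponential_prob rate (B m) * (p (j m))%:E *
         (if injectiveb (s m) then (n ^_ d (j m))%:R^-1 else 0)%:E *
         F (j m) (A m)))%E }.

Section path.
Context {n : nat} {rate : R} {p : J -> R} {dO : measure_display}
  {O : measurableType dO} {P : probability O R}.
Variable D : arrivals n rate p P.

(* the workloads just after the first m arrivals, w being those at time 0 *)
Fixpoint after_arrivals (w : n.-tuple R) (m : nat) (o : O) : n.-tuple R :=
  if m is m'.+1 then
    let j := cls D m' o in
    add_job (k j) (sel D m' j o) (siz D m' j o)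
      (drain (after_arrivals w m' o) (gap D m' o))
  else w.

Definition epoch (m : nat) (o : O) : R := \sum_(i < m) gap D i o.

(* the number of arrivals in [0, t]; it is well defined unless the epochs
   accumulate, which has probability 0 *)
Definition num_arrivals (t : R) (o : O) : nat :=
  xget 0%N [set m | epoch m o <= t < epoch m.+1 o].

(* the workloads at time t >= 0, started at w *)
Definition workload (w : n.-tuple R) (t : R) (o : O) : n.-tuple R :=
  let m := num_arrivals t o in
  drain (after_arrivals w m o) (t - epoch m o).

Definition return_time (o : O) : \bar R :=
  ereal_inf [set t%:E | t in [set t | workload (empty n) t o = empty n /\
    exists2 s, 0 <= s < t & workload (empty n) s o <> empty n]].

Definition stable : Prop :=
  (forall w : n.-tuple R, nonneg w ->
     {ae P, forall o, exists2 t, 0 <= t & workload w t o = empty n}) /\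
  (\int[P]_o return_time o < +oo)%E.

Definition stationary (mu : probability (n.-tuple R) R) : Prop :=
  mu [set w | nonneg w] = 1%E /\
  forall (t : R) (A : set (n.-tuple R)), 0 <= t -> measurable A ->
    (\int[mu]_w P [set o | A (workload w t o)] = mu A)%E.

End path.
End process.
Arguments arrivals {R J d} F {n} rate p {dO O} P.
Arguments stable {R J} k {d F n rate p dO O P} D.
Arguments stationary {R J} k {d F n rate p dO O P} D mu.

(* Main.v *)
From HB Require Import structures.
Require Import Defs.
From mathcomp Require Import ring lra zify.

(* The Lyapunov function is V(w) = sum_i (w_i - mean w)^2. If w_i <= w_l, then
   exchanging the roles of servers i and l in the selection made by a job shows,
   for any fixed component sizes, that i receives at least as much work as l.
   Hence the work brought by a job is anticorrelated with the workloads, and an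
   arrival increases V on average by at most the sum of the second moments of
   its component sizes. For the nontrivial class, compare with a median m: a
   server far below m, put among servers above m, receives its whole component,
   while among jobs falling above m some component is cut with a positive
   probability by (i); a server far above m, put among servers below m, receives
   nothing, while jobs falling below m bring some work by (ii). As at least half
   of the servers are on each side of m, this gives a negative drift
   proportional to sum_i |w_i - m| / n, uniformly in n.

   Between arrivals V decreases. For the truncation min(V, K), invariance of the
   stationary law over [0, t] therefore gives, after division by the probability
   of an arrival and as t -> 0, that the mean of min(V, K) is at most its mean
   after one additional job: the arrival rate cancels, which is why the bound is
   uniform in lambda. Letting K -> oo yields the bound on the mean deviation. *)

Set Implicit Arguments.
Unset Strict Implicit.
Unset Printing Implicit Defensive.

Import Order.TTheory GRing.Theory Num.Theory.
Import numFieldNormedType.Exports.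

Local Open Scope classical_set_scope.
Local Open Scope ring_scope.

(** * Order statistics, mean deviations and injections *)

Lemma kth_smallestE (R : realType) (d k : nat) (xi : d.-tuple R) :
  kth_smallest k xi = kth_smallest k [tuple tnth xi a | a < d].
Proof. by congr kth_smallest; rewrite -[in LHS](map_tnth_enum xi). Qed.

Section kth_smallest.
Context {R : realType} {d : nat} (k : nat).
Hypothesis k_d : (1 <= k <= d)%N.
Implicit Types f g : 'I_d -> R.

(** In the sorted tuple the entries at most [x] come first. Through this count, bounds on completion
    times reduce to inclusions between sets of slots. *)
Lemma kth_smallest_le f x :
  (kth_smallest k [tuple f a | a < d] <= x) =
  (k <= #|[set a | (f a <= x)%R]%SET|)%N.
Proof.
have -> : #|[set a | (f a <= x)%R]%SET| = count (<= x) [tuple f a | a < d].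
  by rewrite cardsE cardE size_filter /= count_map -enumT.
have /andP[k0 kd] := k_d.
have ss : sorted <=%R (sort <=%R [tuple f a | a < d]).
  exact: (@sort_le_sorted _ R).
have <- := seq.permP (permEl (perm_sort <=%R [tuple f a | a < d])) (<= x).
apply/idP/idP; last first.
  by move=> h; apply: nth_count_le => //; rewrite prednK.
apply: contraLR; rewrite -ltnNge -ltNge => h.
apply: nth_count_gt => //; rewrite size_sort size_tuple.
by rewrite -ltnS prednK// h.
Qed.

Lemma kth_smallest_ge f y : (forall a, y <= f a) ->
  y <= kth_smallest k [tuple f a | a < d].
Proof.
move=> yf; have := kth_smallest_le f (kth_smallest k [tuple f a | a < d]).
rewrite lexx => /esym h; have /andP[k0 _] := k_d.
have /card_gt0P[a] := leq_trans k0 h.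
by rewrite inE; exact: le_trans.
Qed.

End kth_smallest.

Section sums.
Context {R : realFieldType} {n : nat}.
Implicit Types x y : 'I_n -> R.

Definition mean x : R := n%:R^-1 * \sum_i x i.

Definition sqdev x : R := \sum_i (x i - mean x) ^+ 2.

Lemma sum_const_ord (c : R) : \sum_(i < n) c = n%:R * c.
Proof. by rewrite sumr_const card_ord mulr_natl. Qed.

Lemma mean_devE x : (0 < n)%N -> \sum_i (x i - mean x) = 0.
Proof.
move=> n0; rewrite big_split/= sum_const_ord mulrN.
have n0' : n%:R != 0 :> R by rewrite pnatr_eq0 -lt0n.
by rewrite /mean mulrA divff// mul1r subrr.
Qed.

(** Covariance as a sum over pairs, so that its sign can be studied two servers at a time. *)
Lemma mean_dev_pair x y : (0 < n)%N ->
  \sum_i (x i - mean x) * y i =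
  (2 * n%:R)^-1 * \sum_i \sum_l (x i - x l) * (y i - y l).
Proof.
move=> n0; have n0' : n%:R != 0 :> R by rewrite pnatr_eq0 -lt0n.
have E i : \sum_l (x i - x l) * (y i - y l) =
    n%:R * ((x i - mean x) * y i) - x i * (\sum_l y l)
    + \sum_l x l * y l.
  transitivity (\sum_l (x i * y i - y i * x l - x i * y l + x l * y l)).
    by apply: eq_bigr => l _; ring.
  by rewrite !big_split/= !sumrN -!mulr_sumr sum_const_ord /mean; field.
under [in RHS]eq_bigr do rewrite E.
rewrite !big_split/= sumrN -mulr_sumr -mulr_suml sum_const_ord.
have -> : \sum_i (x i - mean x) * y i =
    \sum_i x i * y i - mean x * \sum_i y i.
  under eq_bigr do rewrite mulrBl.
  by rewrite big_split/= sumrN mulr_sumr.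
by rewrite /mean; field.
Qed.

Lemma sqdev_pair x : (0 < n)%N ->
  sqdev x = (2 * n%:R)^-1 * \sum_i \sum_l (x i - x l) ^+ 2.
Proof.
move=> n0; transitivity (\sum_i (x i - mean x) * x i).
  transitivity (\sum_i (x i - mean x) * x i - mean x * \sum_i (x i - mean x)).
    by rewrite /sqdev mulr_sumr -sumrB; apply: eq_bigr => i _; ring.
  by rewrite mean_devE// mulr0 subr0.
by rewrite mean_dev_pair//.
Qed.

Lemma sqdev_ge0 x : 0 <= sqdev x.
Proof. by apply: sumr_ge0 => i _; exact: sqr_ge0. Qed.

Lemma sqdev_lipschitz x y : (0 < n)%N ->
  (forall i l, `|x i - x l| <= `|y i - y l|) -> sqdev x <= sqdev y.
Proof.
move=> n0 xy; rewrite !sqdev_pair// ler_wpM2l ?invr_ge0 ?mulr_ge0//.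
apply: ler_sum => i _; apply: ler_sum => l _.
by rewrite -(real_normK (num_real (x i - x l))) -(real_normK (num_real (y i - y l)))
  lerXn2r ?nnegrE.
Qed.

(** The excess of the right side is [n (mean x - c)^2], since the cross terms sum to 0. *)
Lemma sqdev_le_min x c : (0 < n)%N -> sqdev x <= \sum_i (x i - c) ^+ 2.
Proof.
move=> n0; rewrite -subr_ge0 /sqdev -sumrB.
rewrite (_ : \sum_i _ = \sum_i
  (2 * (mean x - c) * (x i - mean x) + (mean x - c) ^+ 2)); last first.
  by apply: eq_bigr => i _; ring.
rewrite big_split/= -mulr_sumr mean_devE// mulr0 add0r.
by apply: sumr_ge0 => i _; exact: sqr_ge0.
Qed.

(** Centring [y] at the mean of [x] instead of its own mean can only increase the sum; the expansion
    is then exact. *)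
Lemma sqdev_shift x y : (0 < n)%N -> sqdev y <=
  sqdev x + 2 * (\sum_i (x i - mean x) * (y i - x i)) + \sum_i (y i - x i) ^+ 2.
Proof.
move=> n0; apply: (le_trans (sqdev_le_min y (mean x) n0)).
rewrite le_eqVlt; apply/orP; left; apply/eqP.
rewrite /sqdev mulr_sumr -!big_split/=; apply: eq_bigr => i _; ring.
Qed.

(** Triangle inequality through [m], together with [n |mean x - m| <= \sum_i |x i - m|]. *)
Lemma mad_pair x m : (0 < n)%N ->
  \sum_i `|x i - mean x| <= 2 * \sum_i `|x i - m|.
Proof.
move=> n0; have n0' : n%:R != 0 :> R by rewrite pnatr_eq0 -lt0n.
have mm : n%:R * `|mean x - m| <= \sum_i `|x i - m|.
  have -> : mean x - m = n%:R^-1 * \sum_i (x i - m).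
    by rewrite big_split/= sum_const_ord /mean; field.
  rewrite normrM ger0_norm ?invr_ge0// mulrA divff// mul1r.
  exact: ler_norm_sum.
rewrite mulr_natl mulr2n; apply: le_trans (lerD (lexx _) mm).
rewrite -sum_const_ord -big_split/=.
apply: ler_sum => i _; rewrite [`|mean x - m|]distrC.
by rewrite (le_trans _ (ler_normD _ _))// addrA subrK.
Qed.

(** Take the least value [x j] with at least half of the entries at or below it. If fewer than half
    were at or above it, more than half would lie strictly below, and the largest of these would be
    a smaller candidate. *)
Lemma median_ex x : (0 < n)%N -> exists m,
  (n <= 2 * #|[set i | (m <= x i)%R]%SET|)%N /\
  (n <= 2 * #|[set i | (x i <= m)%R]%SET|)%N.
Proof.
move=> n0; pose i0 := Ordinal n0.
pose Q i := (n <= 2 * #|[set l | (x l <= x i)%R]%SET|)%N.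
have [i1 _ i1max] := @arg_maxP _ _ _ i0 predT x isT.
have Q1 : Q i1.
  rewrite /Q (_ : [set l | x l <= x i1]%SET = [set: 'I_n]%SET) ?cardsT ?card_ord.
    by lia.
  by apply/setP => l; rewrite !inE; exact: i1max.
have [j Qj jmin] := @arg_minP _ _ _ i1 Q x Q1.
exists (x j); split => //.
rewrite leqNgt; apply/negP => h.
have cC : (#|[set i | (x j <= x i)%R]%SET| + #|[set i | (x i < x j)%R]%SET| = n)%N.
  rewrite -[RHS]card_ord -(cardsC [set i | x j <= x i]%SET); congr (_ + _)%N.
  by apply: eq_card => i; rewrite !inE ltNge.
have c0 : (0 < #|[set i | (x i < x j)%R]%SET|)%N by lia.
have /card_gt0P[l0] := c0; rewrite inE => l0j.
have [l lj lmax] := @arg_maxP _ _ _ l0 (fun l => x l < x j) x l0j.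
have Ql : Q l.
  rewrite /Q; suff : (#|[set i | (x i < x j)%R]%SET| <=
      #|[set i | (x i <= x l)%R]%SET|)%N by lia.
  by apply: subset_leq_card; apply/fintype.subsetP => i; rewrite !inE => /lmax.
by have := jmin _ Ql; rewrite leNgt lj.
Qed.

End sums.

Section injections.
Context {R : numFieldType} {n d : nat}.

Lemma sum_inj_le (s : 'I_d -> 'I_n) (A : {pred 'I_n}) (f : 'I_n -> R) :
  injective s -> (forall a, s a \in A) -> (forall i, i \in A -> 0 <= f i) ->
  \sum_a f (s a) <= \sum_(i in A) f i.
Proof.
move=> s_inj sA f0.
have <- : \sum_(i in s @: [set: 'I_d]%SET) f i = \sum_a f (s a).
  by rewrite big_imset/=; [apply: eq_bigl => a; rewrite inE|move=> a b _ _; exact: s_inj].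
rewrite big_mkcond [leRHS]big_mkcond/=; apply: ler_sum => i _.
case: ifPn => [/imsetP[a _ ->]|_]; first by rewrite sA.
by case: ifPn => // /f0.
Qed.

(** At least a fraction [4^-d] of the injective selections stay inside a given half of the servers,
    whatever [n] is. It holds factor by factor: [n - e <= 4 (N - e)] for [e < d]. *)
Lemma ffact_half (N : nat) : (4 * d <= n)%N -> (n <= 2 * N)%N ->
  (n ^_ d)%:R <= 4%:R ^+ d * (N ^_ d)%:R :> R.
Proof.
move=> dn nN; rewrite -natrX -natrM ler_nat.
suff H e : (e <= d)%N -> (n ^_ e <= 4 ^ e * N ^_ e)%N by exact: H.
elim: e => [|e IH] ed; first by rewrite !ffactn0.
rewrite !ffactnSr expnS.
apply: (@leq_trans ((4 ^ e * N ^_ e) * (4 * (N - e)))%N); last by nia.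
by apply: leq_mul; [apply: IH; lia|lia].
Qed.

Lemma card_inj : #|[pred s : {ffun 'I_d -> 'I_n} | injectiveb s]| = (n ^_ d)%N.
Proof.
rewrite -[in RHS](card_ord n) -[in RHS](card_ord d) -card_inj_ffuns.
by apply: eq_card => s; rewrite !inE.
Qed.

Lemma card_inj_in (A : {set 'I_n}) :
  #|[set s : {ffun 'I_d -> 'I_n} | injectiveb s && [forall a, s a \in A]]%SET|
  = (#|A| ^_ d)%N.
Proof.
rewrite -[in RHS](card_ord d) -(card_inj_ffuns_on _ (mem A)); apply: eq_card => s.
by rewrite !inE andbC; congr (_ && _); apply/forallP/ffun_onP.
Qed.

End injections.

(** * Work brought by a job *)

Section jump.
Context {R : realType} {n d : nat} (k : nat).
Hypothesis k_d : (1 <= k <= d)%N.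
Variable xi : d.-tuple R.
Hypothesis xi0 : nonneg xi.
Variable w : n.-tuple R.
Implicit Types s : {ffun 'I_d -> 'I_n}.

Definition jump (s : {ffun 'I_d -> 'I_n}) i : R :=
  tnth (add_job k s xi w) i - tnth w i.

Let T s := kth_smallest k [tuple tnth w (s a) + tnth xi a | a < d].

(** The time the job would take on idle servers. *)
Let kap := kth_smallest k xi.

Let kapE : kap = kth_smallest k [tuple tnth xi a | a < d].
Proof. exact: kth_smallestE. Qed.

(** Injectivity of [s] forces the slot found by [pick] in [add_job] to be [a]. *)
Lemma jump_sel s a : injective s ->
  jump s (s a) = Num.max 0 (Num.min (tnth xi a) (T s - tnth w (s a))).
Proof.
move=> s_inj; rewrite /jump /add_job tnth_mktuple.
case: pickP => [b /eqP/s_inj ->|/(_ a)]; last by rewrite eqxx.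
by rewrite -/(T s) addr_maxl subrr addr_minl addrAC subrr add0r.
Qed.

Lemma jump_unsel s i : (forall a, s a != i) -> jump s i = 0.
Proof.
move=> si; rewrite /jump /add_job tnth_mktuple; case: pickP => [a|_].
  by rewrite (negbTE (si a)).
by rewrite subrr.
Qed.

Lemma jump_ge0 s i : 0 <= jump s i.
Proof.
rewrite /jump /add_job tnth_mktuple; case: pickP => [a _|_]; last by rewrite subrr.
by rewrite subr_ge0 le_max lexx.
Qed.

Lemma jump_le s a : injective s -> jump s (s a) <= tnth xi a.
Proof.
by move=> s_inj; rewrite jump_sel// ge_max xi0/= ge_min lexx.
Qed.

Lemma sum_jump_sqr_le s : injective s ->
  \sum_i jump s i ^+ 2 <= \sum_a tnth xi a ^+ 2.
Proof.
move=> s_inj; apply: (@le_trans _ _ (\sum_a jump s (s a) ^+ 2)); last first.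
  by apply: ler_sum => a _; rewrite lerXn2r ?nnegrE ?jump_ge0 ?jump_le ?xi0.
have -> : \sum_a jump s (s a) ^+ 2 =
    \sum_(i in s @: [set: 'I_d]%SET) jump s i ^+ 2.
  by rewrite big_imset/=; [apply: eq_bigl => a; rewrite inE|move=> a b _ _; exact: s_inj].
rewrite [leRHS]big_mkcond/=; apply: ler_sum => i _; case: ifPn => // iNs.
rewrite jump_unsel ?expr0n// => a; apply: contra iNs => /eqP <-.
by rewrite imset_f.
Qed.

(** The transposition acts on server labels, after [s]. It is an involution preserving injectivity,
    hence a reindexing of sums over selections. *)
Definition swap_servers (i l : 'I_n) s : {ffun 'I_d -> 'I_n} :=
  [ffun a => tperm i l (s a)].

Lemma swap_serversK i l : involutive (swap_servers i l).
Proof. by move=> s; apply/ffunP => a; rewrite !ffunE tpermK. Qed.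

Lemma injectiveb_swap i l s : injectiveb (swap_servers i l s) = injectiveb s.
Proof.
apply/injectiveP/injectiveP => s_inj a b.
  by move=> sab; apply: s_inj; rewrite !ffunE sab.
by rewrite !ffunE => /perm_inj/s_inj.
Qed.

(** Replacing [i] by the busier server [l] delays completion by at most [w_l - w_i], so the time
    left between the workload and the completion does not grow, unless the component on [i] was
    served in full anyway. *)
Lemma jump_swap i l s : injective s -> tnth w i <= tnth w l ->
  jump (swap_servers i l s) l <= jump s i.
Proof.
move=> s_inj wil.
have t_inj : injective (swap_servers i l s).
  by apply/injectiveP; rewrite injectiveb_swap; exact/injectiveP.
have [a /eqP sa|si] := pickP [pred a | s a == i]; last first.
  rewrite jump_unsel ?jump_ge0// => a; rewrite ffunE.
  apply: contraFneq (si a) => /= ta.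
  by rewrite -(tpermK i l (s a)) ta tpermR.
have ta : swap_servers i l s a = l by rewrite ffunE sa tpermL.
have := jump_sel a t_inj; rewrite ta => ->.
have := jump_sel a s_inj; rewrite sa => ->.
rewrite ge_max !le_max lexx/=; apply/orP; right.
rewrite le_min ge_min lexx/=.
have [|h] := leP (tnth xi a) (T s - tnth w i).
  by move=> h; rewrite ge_min h.
rewrite ge_min; apply/orP; right.
(* The component in slot [a] is cut, so [a] is not among the slots finished by [T s]. Those slots
   remain finished by the delayed time after the exchange. *)
suff : T (swap_servers i l s) <= T s + (tnth w l - tnth w i) by lra.
rewrite (kth_smallest_le k_d).
have := lexx (T s); rewrite {1}/T (kth_smallest_le k_d) => kT.
apply: (leq_trans kT); apply: subset_leq_card; apply/fintype.subsetP => b.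
rewrite !inE ffunE => hb.
have ba : b != a by apply: contraTneq hb => ->; rewrite sa -ltNge; lra.
have sbi : s b != i by rewrite -sa (inj_eq s_inj).
case: tpermP => [sb|sb|_ _]; first by rewrite sb eqxx in sbi.
  by rewrite sb in hb; lra.
lra.
Qed.

(** Relative to the busiest selected server, the [k] smallest components are all finished after a
    further time [kap]. *)
Lemma jump_top s b : injective s ->
  (forall a, tnth w (s a) <= tnth w (s b)) -> jump s (s b) <= kap.
Proof.
move=> s_inj top; rewrite jump_sel// ge_max.
have -> : 0 <= kap by rewrite kapE; exact: (kth_smallest_ge k_d).
rewrite ge_min/=; apply/orP; right; rewrite lerBlDr (kth_smallest_le k_d).
have := lexx kap; rewrite {1}kapE (kth_smallest_le k_d) => kk.
apply: (leq_trans kk); apply: subset_leq_card; apply/fintype.subsetP => c.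
by rewrite !inE => hc; have := top c; lra.
Qed.

(** Among the slots finished by [T s], the one with the largest component receives it in full. There
    are at least [k] such slots, so that component is at least [kap]. *)
Lemma sum_jump_ge s : injective s -> kap <= \sum_a jump s (s a).
Proof.
move=> s_inj.
have := lexx (T s); rewrite {1}/T (kth_smallest_le k_d) => kT.
suff [a aT ka] : exists2 a, tnth w (s a) + tnth xi a <= T s & kap <= tnth xi a.
  rewrite (bigD1 a)//= jump_sel// (le_trans ka)//.
  apply: (@le_trans _ _
    (Num.max 0 (Num.min (tnth xi a) (T s - tnth w (s a))))).
    by rewrite le_max le_min lexx/=; apply/orP; right; lra.
  by rewrite lerDl; apply: sumr_ge0 => b _; exact: jump_ge0.
have [b bT] : exists b, b \in [set a | (tnth w (s a) + tnth xi a <= T s)%R]%SET.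
  by apply/card_gt0P; apply: leq_trans kT; have /andP[] := k_d.
rewrite inE in bT.
have [c cT cmax] := @arg_maxP _ _ _ b
  (fun a => tnth w (s a) + tnth xi a <= T s) (tnth xi) bT.
exists c => //; rewrite kapE (kth_smallest_le k_d) (leq_trans kT)//.
apply: subset_leq_card; apply/fintype.subsetP => a.
by rewrite !inE => /cmax.
Qed.

End jump.

(** * Drift of the squared deviations for fixed component sizes *)

Section drift.
Context {R : realType} {n d : nat} (k : nat).
Hypothesis k_d : (1 <= k <= d)%N.
Variable xi : d.-tuple R.
Hypothesis xi0 : nonneg xi.
Variable w : n.-tuple R.
Implicit Types s : {ffun 'I_d -> 'I_n}.

Let kap := kth_smallest k xi.
Let jump := jump k xi w.

(** Division by [n ^_ d], the number of injective selections, gives the mean work received by server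
    [i]. *)
Definition total_jump i : R := \sum_(s : {ffun 'I_d -> 'I_n} | injectiveb s) jump s i.

(** The exchange of [i] and [l] pairs the two sums term by term. Here [i] takes the place of [l] in
    [s]; in [total_jumpBr], [l] takes the place of [i]. *)
Lemma total_jumpBl i l : total_jump i - total_jump l =
  \sum_(s : {ffun 'I_d -> 'I_n} | injectiveb s) (jump (swap_servers i l s) i - jump s l).
Proof.
rewrite big_split/= sumrN; congr (_ - _).
rewrite /total_jump (reindex_inj (inv_inj (@swap_serversK n d i l)))/=.
by apply: eq_bigl => s; rewrite injectiveb_swap.
Qed.

Lemma total_jumpBr i l : total_jump i - total_jump l =
  \sum_(s : {ffun 'I_d -> 'I_n} | injectiveb s) (jump s i - jump (swap_servers i l s) l).
Proof.
rewrite big_split/= sumrN; congr (_ - _).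
rewrite /total_jump (reindex_inj (inv_inj (@swap_serversK n d i l)))/=.
by apply: eq_bigl => s; rewrite injectiveb_swap.
Qed.

Lemma total_jump_anti i l :
  tnth w i <= tnth w l -> total_jump l <= total_jump i.
Proof.
move=> wil; rewrite -subr_ge0 total_jumpBr; apply: sumr_ge0 => s /injectiveP s_inj.
by rewrite subr_ge0 jump_swap.
Qed.

Let inj_in (A : {set 'I_n}) s := injectiveb s && [forall a, s a \in A].

(* When [i] takes the slot of a server [l] of [U] in a selection contained in [U],
   the component placed on [i] finishes first. *)
Lemma total_jump_low (m D : R) i (U := [set l | m <= tnth w l]%SET) :
  0 <= D -> (forall a, tnth xi a <= D) ->
  tnth w i + D <= m ->
  \sum_(s | inj_in U s) \sum_a (tnth xi a - jump s (s a))
  <= \sum_(l in U) (total_jump i - total_jump l).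
Proof.
move=> D0 xiD wim.
under [leRHS]eq_bigr do rewrite total_jumpBl.
rewrite [leRHS]exchange_big/= [leLHS]big_mkcondr/=.
apply: ler_sum => s /injectiveP s_inj.
have pos l : l \in U -> 0 <= jump (swap_servers i l s) i - jump s l.
  rewrite inE => ml; rewrite subr_ge0 -{1}(@swap_serversK n d i l s).
  apply: jump_swap => //; last by lra.
  by apply/injectiveP; rewrite injectiveb_swap; exact/injectiveP.
case: ifPn => [/forallP sU|_]; last exact: sumr_ge0.
(* Only the servers [l = s a] of the selection are kept; the other terms are nonnegative. *)
apply: (le_trans _ (sum_inj_le s_inj sU pos)); apply: ler_sum => a _.
rewrite lerD2r.
have t_inj : injective (swap_servers i (s a) s).
  by apply/injectiveP; rewrite injectiveb_swap; exact/injectiveP.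
have ta : swap_servers i (s a) s a = i by rewrite ffunE tpermR.
have := jump_sel k xi w a t_inj; rewrite ta /jump => ->.
rewrite le_max le_min lexx/=; apply/orP; right.
(* Any slot other than [a] sits on a server with workload at least [m >= w_i + D], so it finishes no
   earlier than slot [a]. *)
rewrite lerBrDl; apply: (kth_smallest_ge k_d) => b.
have [->|ba] := eqVneq b a; first by rewrite ta.
have := sU a; have := sU b; rewrite !inE ffunE => hb ha.
have xia := xiD a; have xib := xi0 b.
by case: tpermP => [sb|/s_inj sb|_ _]; [lra|rewrite sb eqxx in ba|lra].
Qed.

(* When [l] takes a slot in a selection contained in [L], the job completes on the
   other servers before the workload [tnth w l] is reached. *)
Lemma total_jump_high (m D : R) l (L := [set i | tnth w i <= m]%SET) :
  0 <= D -> (forall a, tnth xi a <= D) ->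
  (k < d)%N -> m + D <= tnth w l ->
  \sum_(s | inj_in L s) \sum_a jump s (s a)
  <= \sum_(i in L) (total_jump i - total_jump l).
Proof.
move=> D0 xiD kd wlm.
under [leRHS]eq_bigr do rewrite total_jumpBr.
rewrite [leRHS]exchange_big/= [leLHS]big_mkcondr/=.
apply: ler_sum => s /injectiveP s_inj.
have pos i : i \in L -> 0 <= jump s i - jump (swap_servers i l s) l.
  by rewrite inE => im; rewrite subr_ge0 jump_swap//; lra.
case: ifPn => [/forallP sL|_]; last exact: sumr_ge0.
apply: (le_trans _ (sum_inj_le s_inj sL pos)); apply: ler_sum => a _.
rewrite lerBrDr gerDl.
have t_inj : injective (swap_servers (s a) l s).
  by apply/injectiveP; rewrite injectiveb_swap; exact/injectiveP.
have ta : swap_servers (s a) l s a = l by rewrite ffunE tpermL.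
have := jump_sel k xi w a t_inj; rewrite ta /jump => ->.
rewrite ge_max lexx/= ge_min subr_le0; apply/orP; right.
rewrite (kth_smallest_le k_d).
(* The [d - 1 >= k] slots other than [a] finish by [m + D], hence by [w_l]: nothing is left for
   [l]. *)
apply: (@leq_trans #|~: [set a]%SET|).
  by have := cardsC [set a]%SET; rewrite cards1 card_ord; lia.
apply: subset_leq_card; apply/fintype.subsetP => b; rewrite !inE ffunE => ba.
have := sL a; have := sL b; rewrite !inE => hb ha.
have xib := xiD b.
case: tpermP => [/s_inj sb|sb|_ _]; [by rewrite sb eqxx in ba|lra|lra].
Qed.

(** This transposition acts before [s]: the selected servers stay the same and the components are
    redistributed among them. *)
Let swap_slots a b s : {ffun 'I_d -> 'I_n} := [ffun c => s (tperm a b c)].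

Let swap_slotsK a b : involutive (swap_slots a b).
Proof. by move=> s; apply/ffunP => c; rewrite !ffunE tpermK. Qed.

Let inj_in_swap_slots A a b s : inj_in A (swap_slots a b s) = inj_in A s.
Proof.
suff H t : inj_in A t -> inj_in A (swap_slots a b t).
  by apply/idP/idP => /H//; rewrite swap_slotsK.
move=> /andP[/injectiveP t_inj /forallP tA]; apply/andP; split.
  by apply/injectiveP => c c'; rewrite !ffunE => /t_inj/perm_inj.
by apply/forallP => c; rewrite ffunE.
Qed.

(* A transposition of slots puts the busiest selected server in slot [a]; there
   the component is cut down to at most [kap]. *)
Lemma sum_deficit (A : {set 'I_n}) a :
  (#|A| ^_ d)%:R * (tnth xi a - kap) <=
  d%:R * \sum_(s | inj_in A s) \sum_b (tnth xi b - jump s (s b)).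
Proof.
(* The sum over selections is invariant under each transposition of slots. Summing over all [c]
   costs the factor [d] and makes available, for each [s], the slot of its own busiest server. *)
have E c : \sum_(s | inj_in A s) \sum_b (tnth xi b - jump s (s b)) =
    \sum_(s | inj_in A s)
    \sum_b (tnth xi b - jump (swap_slots c a s) (swap_slots c a s b)).
  rewrite [LHS](reindex_inj (inv_inj (@swap_slotsK c a)))/=.
  by apply: eq_bigl => s; rewrite inj_in_swap_slots.
rewrite -[leRHS]sum_const_ord; under [leRHS]eq_bigr => c _ do rewrite (E c).
rewrite exchange_big/= -card_inj_in [leLHS]mulr_natl -[leLHS]sumr_const big_mkcond/=.
rewrite [leRHS]big_mkcond/=; apply: ler_sum => s _; rewrite inE -/(inj_in A s).
case: ifPn => // /andP[/injectiveP s_inj _].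
have f0 c b : 0 <= tnth xi b - jump (swap_slots c a s) (swap_slots c a s b).
  rewrite subr_ge0 jump_le// => b1 b2; rewrite !ffunE.
  by move=> /s_inj/perm_inj.
have [c _ cmax] := @arg_maxP _ _ _ a predT (fun c => tnth w (s c)) isT.
(* Only the busiest slot [c], transposed with [a], and the deficit in slot [a] are kept. *)
rewrite (bigD1 c)//= (bigD1 a)//= -addrA ler_wpDr//.
  by rewrite addr_ge0 ?sumr_ge0// => b _; exact: sumr_ge0.
rewrite lerD2l lerN2; apply: jump_top => // [b1 b2|b].
  by rewrite !ffunE => /s_inj/perm_inj.
by rewrite !ffunE tpermR; exact: cmax.
Qed.

Lemma sum_surplus (A : {set 'I_n}) :
  (#|A| ^_ d)%:R * kap <= \sum_(s | inj_in A s) \sum_b jump s (s b).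
Proof.
rewrite -card_inj_in [leLHS]mulr_natl -[leLHS]sumr_const big_mkcond/= [leRHS]big_mkcond/=.
apply: ler_sum => s _; rewrite inE -/(inj_in A s).
by case: ifPn => // /andP[/injectiveP s_inj _]; exact: sum_jump_ge.
Qed.

Let dev := \sum_i (tnth w i - mean (tnth w)) * total_jump i.

(** Contribution of a pair of servers to the decrease. As it is nonnegative, the drift can be
    bounded by keeping only well-chosen pairs. *)
Let G i l := (tnth w l - tnth w i) * (total_jump i - total_jump l).

Let G0 i l : 0 <= G i l.
Proof.
rewrite /G; have [wil|wil] := leP (tnth w i) (tnth w l).
  by rewrite mulr_ge0 ?subr_ge0 ?total_jump_anti.
by rewrite mulr_le0 ?subr_le0 ?total_jump_anti// ltW.
Qed.

Let devE : (0 < n)%N -> dev = - ((2 * n%:R)^-1 * \sum_i \sum_l G i l).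
Proof.
move=> n0; rewrite /dev mean_dev_pair// -mulrN -sumrN; congr (_ * _).
apply: eq_bigr => i _; rewrite -sumrN; apply: eq_bigr => l _.
by rewrite /G; ring.
Qed.

Lemma drift_le0 : (0 < n)%N -> dev <= 0.
Proof.
move=> n0; rewrite devE// oppr_le0 mulr_ge0 ?invr_ge0 ?mulr_ge0//.
by apply: sumr_ge0 => i _; exact: sumr_ge0.
Qed.

(** Keep the pairs with [i] at least [D] below [m] and [l] above [m], where [w_l - w_i >= m - w_i].
    The factor [d] comes from [sum_deficit], and [2 n] from the pair form of the covariance. *)
Lemma drift_low (m D : R) a : (0 < n)%N -> 0 <= D ->
  (forall a, tnth xi a <= D) ->
  (#|[set l | (m <= tnth w l)%R]%SET| ^_ d)%:R * (tnth xi a - kap)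
  * \sum_(i | tnth w i + D <= m) (m - tnth w i) <= d%:R * (2 * n%:R) * - dev.
Proof.
move=> n0 D0 xiD.
have n0' : n%:R != 0 :> R by rewrite pnatr_eq0 -lt0n.
rewrite devE// opprK -[leRHS]mulrA mulVKf ?mulf_neq0//.
set U := [set l | _]%SET.
apply: (@le_trans _ _ (d%:R * \sum_(i | tnth w i + D <= m)
   (m - tnth w i) * \sum_(l in U) (total_jump i - total_jump l))).
  rewrite [leLHS]mulr_sumr [leRHS]mulr_sumr; apply: ler_sum => i im.
  rewrite [leLHS]mulrC [leRHS]mulrCA ler_wpM2l//; first by lra.
  apply: (le_trans (sum_deficit U a)); rewrite ler_wpM2l//.
  exact: (total_jump_low D0 xiD im).
rewrite ler_wpM2l// [leLHS]big_mkcond/=; apply: ler_sum => i _.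
case: ifPn => im; last exact: sumr_ge0.
rewrite mulr_sumr [leLHS]big_mkcond/=; apply: ler_sum => l _; case: ifPn => //.
rewrite inE => ml; rewrite /G ler_wpM2r// ?lerD2r//.
by rewrite subr_ge0 total_jump_anti//; lra.
Qed.

(** Mirror image of [drift_low]: [l] is at least [D] above [m] and [i] below [m], with [sum_surplus]
    in place of [sum_deficit]. *)
Lemma drift_high (m D : R) : (0 < n)%N -> 0 <= D -> (k < d)%N ->
  (forall a, tnth xi a <= D) ->
  (#|[set i | (tnth w i <= m)%R]%SET| ^_ d)%:R * kap
  * \sum_(l | m + D <= tnth w l) (tnth w l - m) <= (2 * n%:R) * - dev.
Proof.
move=> n0 D0 kd xiD.
have n0' : n%:R != 0 :> R by rewrite pnatr_eq0 -lt0n.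
rewrite devE// opprK mulVKf ?mulf_neq0//.
set L := [set i | _]%SET.
apply: (@le_trans _ _ (\sum_(l | m + D <= tnth w l)
   (tnth w l - m) * \sum_(i in L) (total_jump i - total_jump l))).
  rewrite mulr_sumr; apply: ler_sum => l lm.
  rewrite mulrC ler_wpM2l//; first by lra.
  exact: (le_trans (sum_surplus L) (total_jump_high D0 xiD kd lm)).
rewrite exchange_big/= [leLHS]big_mkcond/=; apply: ler_sum => l _.
case: ifPn => lm; last exact: sumr_ge0.
rewrite mulr_sumr [leLHS]big_mkcond/=; apply: ler_sum => i _; case: ifPn => //.
rewrite inE => im; rewrite /G ler_wpM2r// ?lerD2l ?lerN2//.
by rewrite subr_ge0 total_jump_anti//; lra.
Qed.

End drift.

(** * Average over the uniform selection of servers *)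

Section average_drift.
Context {R : realType} {n d : nat} (k : nat).
Hypothesis k_d : (1 <= k <= d)%N.
Hypothesis d_n : (4 * d <= n)%N.
Variable xi : d.-tuple R.
Hypothesis xi0 : nonneg xi.
Variable w : n.-tuple R.

Let n0 : (0 < n)%N. Proof. by have := k_d; lia. Qed.
Let nd0 : 0 < (n ^_ d)%:R :> R. Proof. by rewrite ltr0n ffact_gt0; lia. Qed.

Let dev := \sum_i (tnth w i - mean (tnth w)) * total_jump k xi w i.

Definition avg_after (f : n.-tuple R -> R) : R :=
  (n ^_ d)%:R^-1 * \sum_(s : {ffun 'I_d -> 'I_n} | injectiveb s)
    f (add_job k s xi w).

(** Sum of [sqdev_shift] over the selections: the linear term becomes the covariance [dev], the
    quadratic one is bounded by the squared sizes. *)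
Let avg_after_sqdev0 : avg_after (fun w => sqdev (tnth w)) <=
  sqdev (tnth w) + \sum_a tnth xi a ^+ 2 + 2 * ((n ^_ d)%:R^-1 * dev).
Proof.
rewrite /avg_after ler_pdivrMl//.
apply: (@le_trans _ _ (\sum_(s : {ffun 'I_d -> 'I_n} | injectiveb s)
  (sqdev (tnth w) + \sum_a tnth xi a ^+ 2 +
   2 * \sum_i (tnth w i - mean (tnth w)) * jump k xi w s i))).
  apply: ler_sum => s /injectiveP s_inj.
  apply: (le_trans (sqdev_shift (tnth w) _ n0)).
  by rewrite addrAC lerD2r lerD2l; exact: sum_jump_sqr_le.
rewrite big_split/= sumr_const card_inj -mulr_sumr exchange_big/=.
set A := sqdev _ + _; rewrite -[A *+ _]mulr_natl [leRHS]mulrDr lerD2l.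
rewrite [leRHS]mulrCA mulVKf ?gt_eqF//.
rewrite ler_wpM2l// /dev le_eqVlt; apply/orP; left; apply/eqP.
by apply: eq_bigr => i _; rewrite /total_jump mulr_sumr.
Qed.

Lemma avg_after_sqdev : avg_after (fun w => sqdev (tnth w)) <=
  sqdev (tnth w) + \sum_a tnth xi a ^+ 2.
Proof.
apply: (le_trans avg_after_sqdev0); rewrite gerDl pmulr_rle0//.
by rewrite pmulr_rle0 ?invr_gt0//; exact: drift_le0.
Qed.

Variables (m D e : R).
Hypotheses (D0 : 0 <= D) (e0 : 0 <= e).
Hypothesis m_ge : (n <= 2 * #|[set i | (m <= tnth w i)%R]%SET|)%N.
Hypothesis m_le : (n <= 2 * #|[set i | (tnth w i <= m)%R]%SET|)%N.
Hypothesis kd : (k < d)%N.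

Definition low_dev := \sum_(i | tnth w i + D <= m) (m - tnth w i).
Definition high_dev := \sum_(i | m + D <= tnth w i) (tnth w i - m).

(** Quantitative versions of the non-triviality conditions (i) and, in [large_sizes], (ii): sizes
    bounded by [D], and a margin [e]. *)
Definition spread_sizes : bool := [forall a, tnth xi a <= D] &&
  [exists a, kth_smallest k xi + e <= tnth xi a].
Definition large_sizes : bool := [forall a, tnth xi a <= D] &&
  (e <= kth_smallest k xi).

Let low_dev0 : 0 <= low_dev.
Proof. by apply: sumr_ge0 => i h; have := D0; lra. Qed.
Let high_dev0 : 0 <= high_dev.
Proof. by apply: sumr_ge0 => i h; have := D0; lra. Qed.

(** The low and the high bound each hold for the whole of [- dev]; the factor 2 in front of [dev]
    pays for their sum. The power of 4 comes from [ffact_half], as each side of [m] holds half of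
    the servers. *)
Lemma avg_after_sqdev_strict : avg_after (fun w => sqdev (tnth w)) <=
  sqdev (tnth w) + \sum_a tnth xi a ^+ 2 -
  e / (4%:R ^+ d * (2 * d%:R * n%:R)) *
    (spread_sizes%:R * low_dev + large_sizes%:R * high_dev).
Proof.
apply: (le_trans avg_after_sqdev0); rewrite lerD2l lerNr -mulrN -mulrN.
have d1 : 1 <= d%:R :> R by rewrite ler1n; have := k_d; lia.
have n1 : 0 < n%:R :> R by rewrite ltr0n.
have q0 : 0 < 4%:R ^+ d :> R by rewrite exprn_gt0.
have dev0 : 0 <= - dev by rewrite oppr_ge0; exact: drift_le0.
have L : spread_sizes%:R * (e * low_dev) * (n ^_ d)%:R <=
    4%:R ^+ d * (d%:R * (2 * n%:R) * - dev).
  rewrite /spread_sizes; case: andP => [[/forallP xiD /existsP[a xia]]|_]; last first.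
    by rewrite !mul0r !mulr_ge0// ltW.
  have := drift_low k_d xi0 w m a n0 D0 xiD.
  rewrite -/dev -/low_dev; move=> /(ler_wpM2l (ltW q0)); apply: le_trans.
  rewrite mul1r [leLHS]mulrC !mulrA ler_wpM2r// ler_pM//.
    exact: ffact_half.
  by lra.
have H : large_sizes%:R * (e * high_dev) * (n ^_ d)%:R <=
    4%:R ^+ d * (d%:R * (2 * n%:R) * - dev).
  rewrite /large_sizes; case: andP => [[/forallP xiD xik]|_]; last first.
    by rewrite !mul0r !mulr_ge0// ltW.
  have := drift_high k_d (xi:=xi) w m n0 D0 kd xiD.
  rewrite -/dev -/high_dev; move=> /(ler_wpM2l (ltW q0)) h.
  apply: (@le_trans _ _ (4%:R ^+ d * (2 * n%:R * - dev))); last first.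
    rewrite ler_wpM2l ?(ltW q0)// -[leRHS]mulrA ler_peMl//.
    by rewrite !mulr_ge0// ltW.
  apply: le_trans h.
  rewrite mul1r [leLHS]mulrC !mulrA ler_wpM2r// ler_pM//.
  exact: ffact_half.
have /ler_pM2l <- : 0 < (n ^_ d)%:R * (4%:R ^+ d * (2 * d%:R * n%:R)) :> R.
  by rewrite !mulr_gt0//; lra.
have q1 : 4 ^+ d != 0 :> R by rewrite gt_eqF.
have n2 : n%:R != 0 :> R by rewrite gt_eqF.
have d2 : d%:R != 0 :> R by rewrite gt_eqF//; lra.
have nd2 : (n ^_ d)%:R != 0 :> R by rewrite gt_eqF.
rewrite [leLHS](_ : _ = spread_sizes%:R * (e * low_dev) * (n ^_ d)%:R +
  large_sizes%:R * (e * high_dev) * (n ^_ d)%:R); last by field; rewrite q1 n2 d2.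
rewrite [leRHS](_ : _ = 2 * (4%:R ^+ d * (d%:R * (2 * n%:R) * - dev))); last by field.
by lra.
Qed.

(** Servers within [D] of [m], missing on the right, contribute at most [D] each. *)
Lemma low_high_dev :
  \sum_i `|tnth w i - m| - n%:R * D <= low_dev + high_dev.
Proof.
rewrite -sum_const_ord -sumrB /low_dev /high_dev [X in _ <= X + _]big_mkcond.
rewrite [X in _ <= _ + X]big_mkcond -big_split/=; apply: ler_sum => i _.
have := D0; rewrite lerBlDr => D0'.
case: ifPn => h1; case: ifPn => h2; rewrite ler_norml; apply/andP; split;
  rewrite -?ltNge in h1 h2 *; lra.
Qed.

End average_drift.

(** * The mean deviation of the empirical distribution *)

Section empirical.
Context {R : realType} (n : nat) (v : nat -> R).
Variable y : comp_df R.
Hypothesis yE : forall u, y u = n%:R^-1 * \sum_(i < n) (u < v i)%R%:R.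

Let invn0 : 0 <= n%:R^-1 :> R. Proof. by rewrite invr_ge0. Qed.

Let empirical := mscale (NngNum invn0)
  (msum (fun i => @dirac _ (measurableTypeR R) (v i) R) n).

(** The measure [d[-y_u]] is the average of the Dirac masses at the [v i]: both agree on the
    intervals []a, b]], which determine it. *)
Let df_measureE A : measurable A -> df_measure y A = empirical A.
Proof.
apply: lebesgue_stieltjes_measure_unique => X /ocitvP[->|[[a b] /= ab ->]].
  by rewrite !measure0.
rewrite /lebesgue_stieltjes_measure /measure_extension/=.
rewrite measurable_mu_extE/=; last exact: is_ocitv.
rewrite wlength_itv_bnd; last exact: ltW.
rewrite /mscale/= /msum/= /opp_df opprK.
rewrite (eq_bigr (fun i : 'I_n => ((a < v i)%R%:R - (b < v i)%R%:R : R)%:E)); last first.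
  move=> i _; rewrite diracE mem_setE/= in_itv/=; congr EFin.
  case: (ltP a (v i)) => avi; case: (ltP b (v i)) => bvi /=; rewrite ?subrr ?subr0//.
  by have := lt_trans (le_lt_trans avi ab) bvi; rewrite ltxx.
rewrite sumEFin -EFinM sumrB mulrBr -!yE; congr EFin.
by rewrite addrC.
Qed.

Let ge0_df_integral (f : R -> \bar R) : measurable_fun setT f ->
  (forall u, 0 <= f u)%E ->
  (\int[df_measure y]_u f u = (n%:R^-1)%:E * \sum_(i < n) f (v i))%E.
Proof.
move=> mf f0.
rewrite (@eq_measure_integral _ _ _ setT empirical); last first.
  by move=> A mA _; exact: df_measureE.
rewrite ge0_integral_mscale//= ge0_integral_measure_sum//.
congr (_ * _)%E; apply: eq_bigr => i _.
by rewrite integral_dirac// diracT mul1e.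
Qed.

Lemma df_integral (f : R -> R) : measurable_fun setT f ->
  (\int[df_measure y]_u (f u)%:E = (n%:R^-1 * \sum_(i < n) f (v i))%:E)%E.
Proof.
move=> mf; have mf' : measurable_fun setT (fun u => (f u)%:E) by exact/measurable_EFinP.
rewrite integralE !ge0_df_integral//; last 2 first.
  exact: measurable_funeneg.
  exact: measurable_funepos.
have -> : (\sum_(i < n) ((fun u => (f u)%:E)^\+ (v i)) =
    (\sum_(i < n) Num.max (f (v i)) 0)%:E)%E.
  by rewrite -sumEFin; apply: eq_bigr => i _; rewrite funeposE -EFin_max.
have -> : (\sum_(i < n) ((fun u => (f u)%:E)^\- (v i)) =
    (\sum_(i < n) Num.max (- f (v i)) 0)%:E)%E.
  by rewrite -sumEFin; apply: eq_bigr => i _; rewrite funenegE -EFin_max.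
rewrite -!EFinM -EFinB -mulrBr -sumrB; congr (_ * _)%:E.
apply: eq_bigr => i _; rewrite /Num.max; case: ltP => ?; case: ltP => ?; lra.
Qed.

End empirical.

Section Phi1_occupancy.
Context {R : realType} (n : nat).
Hypothesis n0 : (0 < n)%N.
Variable w : n.-tuple R.

(** Below 0 [tail_fraction] is 1 whatever the signs of the entries, so a negative entry counts as
    0. *)
Let wpos i := Num.max 0 (tnth w i).

Lemma Phi1_occupancy : Phi1 (centered (occupancy w)) =
  (n%:R^-1 * \sum_i `|wpos i - mean wpos|)%:E.
Proof.
pose v i : R := Num.max 0 (nth 0 w i).
have vE (i : 'I_n) : v i = wpos i by rewrite /v -tnth_nth.
have nS : n%:R^-1 * \sum_(i < n) 1 = 1 :> R.
  by rewrite sum_const_ord mulr1 mulVf// pnatr_eq0 -lt0n.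
have occE u : occupancy w u = n%:R^-1 * \sum_(i < n) (u < v i)%R%:R.
  rewrite /= /tail_fraction; have [u0|u0] := ltP u 0.
    rewrite -[LHS]nS; congr (_ * _); apply: eq_bigr => i _.
    by rewrite /v lt_max u0.
  congr (_ * _); apply: eq_bigr => i _.
  by rewrite /v lt_max [u < 0]ltNge u0/= (tnth_nth 0).
have meanE : df_mean (occupancy w) = mean wpos.
  rewrite /df_mean (df_integral occE)//=; congr (_ * _).
  by apply: eq_bigr => i _; rewrite vE.
pose v' i := v i - mean wpos.
have cenE u : centered (occupancy w) u = n%:R^-1 * \sum_(i < n) (u < v' i)%R%:R.
  rewrite [LHS]occE meanE; congr (_ * _); apply: eq_bigr => i _.
  by rewrite /v' ltrBrDr.
(* [Phi1] subtracts the mean of its argument, which is 0 for a centred function. *)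
have mean0 : df_mean (centered (occupancy w)) = 0.
  rewrite /df_mean (df_integral cenE)//=.
  rewrite (eq_bigr (fun i => wpos i - mean wpos)) ?mean_devE ?mulr0// => i _.
  by rewrite /v' vE.
rewrite /Phi1 mean0 (df_integral cenE); last first.
  apply: measurableT_comp => //; exact: measurable_funB.
by congr (_ * _)%:E; apply: eq_bigr => i _; rewrite subr0 /v' vE.
Qed.

End Phi1_occupancy.

(** * Measurability *)

(** Change of variables on an event: restricted to [E], the law of [phi] is [c] times [F]. It serves
    to fix a mark and integrate over the sizes, and, with [E] the whole space, to use
    exchangeability. *)
Lemma integral_slice (R : realType) d1 d2 (O : measurableType d1)
    (Y : measurableType d2) (P : {measure set O -> \bar R})
    (F : {measure set Y -> \bar R}) (E : set O) (phi : O -> Y) (c : R)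
    (h : Y -> \bar R) :
  measurable E -> measurable_fun setT phi -> 0 <= c ->
  (forall A, measurable A -> P (E `&` phi @^-1` A) = (c%:E * F A)%E) ->
  measurable_fun setT h -> (forall y, 0 <= h y)%E ->
  (\int[P]_(o in E) h (phi o) = c%:E * \int[F]_y h y)%E.
Proof.
move=> mE mphi c0 PE mh h0.
have mhphi : measurable_fun setT (h \o phi) by exact: measurableT_comp.
transitivity (\int[mrestr P mE]_o (h (phi o)))%E.
  rewrite -(setvU E) setUC ge0_integral_setU//=; last 3 first.
  - exact: measurableC.
  - by rewrite setUv.
  - exact/disj_setPCl.
  rewrite (@eq_measure_integral _ _ _ E (mrestr P mE)); last first.
    by move=> A mA AE; rewrite /= /mrestr setIidl.
  rewrite [X in (_ + X)%E](_ : _ = 0%E) ?adde0//.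
  rewrite (@eq_measure_integral _ _ _ (~` E) mzero) ?integral_measure_zero//.
  move=> A mA AE /=; rewrite /mrestr (_ : A `&` E = set0) ?measure0//.
  by apply/seteqP; split => // x [/AE].
transitivity (\int[pushforward (mrestr P mE) phi]_y h y)%E.
  by rewrite ge0_integral_pushforward.
pose mphi' := isMeasurableFun.Build _ _ _ _ _ mphi.
pose phi' : {mfun O >-> Y} := HB.pack phi mphi'.
rewrite (@eq_measure_integral _ _ _ setT (mscale (NngNum c0) F)
  (pushforward (mrestr P mE) phi')); last first.
  by move=> A mA _; transitivity (c%:E * F A)%E => //; rewrite -PE// setIC.
by rewrite ge0_integral_mscale.
Qed.

Lemma probability_integral_cst (R : realType) dT (T : measurableType dT)
    (P : probability T R) (r : R) : (\int[P]__ r%:E = r%:E)%E.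
Proof.
rewrite integral_cst// -[RHS]mule1; congr (_ * _)%E; exact: probability_setT.
Qed.

Lemma measurable_nonneg (R : realType) (n : nat) :
  measurable [set w : n.-tuple R | nonneg w].
Proof.
rewrite -[X in measurable X]setCK; apply: measurableC.
rewrite (_ : ~` _ = \bigcup_(i : 'I_n) [set w : n.-tuple R | tnth w i < 0]).
  apply: countable_bigcupT_measurable => // i.
  rewrite -[X in measurable X]setTI.
  apply: (@measurable_fun_ltr _ _ _ _ (@tnth n R ^~ i) (cst 0)) => //.
  exact: measurable_tnth.
apply/seteqP; split => [w /= w0|w [i _ /= wi] w0].
  apply: contrapT => h; apply: w0 => i; rewrite leNgt; apply/negP => wi.
  by apply: h; exists i.
by have := w0 i; rewrite leNgt wi.
Qed.

(** Gluing along a countable partition: the class, the selection and the number of arrivals are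
    random indices of this kind. *)
Lemma measurable_fun_case d1 d2 (T : measurableType d1) (Y : measurableType d2)
    (I : countType) (c : T -> I) (F : I -> T -> Y) :
  (forall i, measurable [set x | c x = i]) ->
  (forall i, measurable_fun setT (F i)) ->
  measurable_fun setT (fun x => F (c x) x).
Proof.
move=> mc mF _ A mA; rewrite setTI.
rewrite (_ : _ @^-1` _ = \bigcup_i ([set x | c x = i] `&` (F i @^-1` A))).
  apply: countable_bigcupT_measurable => // i.
  by apply: measurableI => //; rewrite -[X in measurable X]setTI; exact: mF.
by apply/seteqP; split => [x /= Ax|x [i _ [/= <-]]//]; exists (c x).
Qed.

Section measurable_model.
Context {R : realType}.

(** By [kth_smallest_le], being at most [r] is a condition on a measurable count. *)
Lemma measurable_kth_smallest dT (T : measurableType dT) (d k : nat)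
    (f : 'I_d -> T -> R) : (1 <= k <= d)%N ->
  (forall a, measurable_fun setT (f a)) ->
  measurable_fun setT (fun x => kth_smallest k [tuple f a x | a < d]).
Proof.
move=> k_d mf; apply: (measurability _ (@RGenOInfty.measurableE R)) => //.
move=> _ [_ [r ->] <-].
rewrite setTI -[X in measurable X]setCK.
apply: measurableC.
pose g x : R := \sum_(a < d) (if f a x <= r then 1 else 0).
have mg : measurable_fun setT g.
  apply: measurable_sum => a; apply: measurable_fun_ifT => //.
  exact: measurable_fun_ler.
rewrite (_ : ~` _ = setT `&` (fun x => (k%:R : R) <= g x) @^-1` [set true]); last first.
  apply/seteqP; split => [x /= /negP|x /= [_]].
    rewrite in_itv/= andbT -leNgt (kth_smallest_le k_d) => h; split => //.
    rewrite /g -big_mkcond/= sumr_const ler_nat (leq_trans h)//.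
    by apply: subset_leq_card; apply/fintype.subsetP => a; rewrite !inE.
  rewrite /g -big_mkcond/= sumr_const ler_nat => h.
  apply/negP; rewrite in_itv/= andbT -leNgt (kth_smallest_le k_d) (leq_trans h)//.
  by apply: subset_leq_card; apply/fintype.subsetP => a; rewrite !inE.
exact: measurable_fun_ler.
Qed.

Lemma measurable_add_job dT (T : measurableType dT) (n d k : nat)
    (s : {ffun 'I_d -> 'I_n}) (xi : T -> d.-tuple R) (w : T -> n.-tuple R) :
  (1 <= k <= d)%N -> measurable_fun setT xi -> measurable_fun setT w ->
  measurable_fun setT (fun x => add_job k s (xi x) (w x)).
Proof.
move=> k_d /measurable_fun_tnthP mxi /measurable_fun_tnthP mw.
apply/measurable_fun_tnthP => i; rewrite /comp/= /add_job.
under eq_fun do rewrite tnth_mktuple.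
case: pickP => [a _|_]; last exact: mw.
apply: measurable_maxr; first exact: mw.
apply: measurable_minr; first by apply: measurable_funD; [exact: mw|exact: mxi].
apply: measurable_kth_smallest => // b.
by apply: measurable_funD; [exact: mw|exact: mxi].
Qed.

Lemma measurable_drain dT (T : measurableType dT) (n : nat)
    (w : T -> n.-tuple R) (t : T -> R) :
  measurable_fun setT w -> measurable_fun setT t ->
  measurable_fun setT (fun x => drain (w x) (t x)).
Proof.
move=> /measurable_fun_tnthP mw mt.
apply/measurable_fun_tnthP => i; rewrite /comp/= /drain.
under eq_fun do rewrite tnth_mktuple.
by apply: measurable_maxr => //; apply: measurable_funB => //; exact: mw.
Qed.

Context {J : finType} (k d : J -> nat) (F : forall j, probability ((d j).-tuple R) R).
Context (n : nat) (rate : R) (p : J -> R) (dO : measure_display)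
  (O : measurableType dO) (P : probability O R).
Variable D : arrivals (n := n) F rate p P.
Hypothesis k_d : forall j, (1 <= k j <= d j)%N.

(** Joint measurability in the initial state and the sample point, for Tonelli under [mu \x P]. *)
Lemma measurable_after_arrivals m :
  measurable_fun setT (fun x : n.-tuple R * O => after_arrivals k D x.1 m x.2).
Proof.
elim: m => [|m IH]; first exact: measurable_fst.
have msnd dY (Y : measurableType dY) (f : O -> Y) : measurable_fun setT f ->
    measurable_fun setT (fun x : n.-tuple R * O => f x.2).
  by move=> mf; exact: measurableT_comp.
have msetsnd (A : set O) : measurable A ->
    measurable [set x : n.-tuple R * O | A x.2].
  move=> mA; rewrite -[X in measurable X]setTI.
  exact: (@measurable_snd _ _ _ _ measurableT A mA).
apply: (@measurable_fun_case _ _ _ _ _ (fun x => cls D m x.2)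
  (fun j x => add_job (k j) (sel D m j x.2) (siz D m j x.2)
    (drain (after_arrivals k D x.1 m x.2) (gap D m x.2)))).
  by move=> j; apply: (msetsnd [set o | cls D m o = j]); exact: measurable_cls.
move=> j.
apply: (@measurable_fun_case _ _ _ _ _ (fun x => sel D m j x.2)
  (fun s x => add_job (k j) s (siz D m j x.2)
    (drain (after_arrivals k D x.1 m x.2) (gap D m x.2)))).
  by move=> s; apply: (msetsnd [set o | sel D m j o = s]); exact: measurable_sel.
move=> s; apply: measurable_add_job => //.
  by apply: msnd; exact: measurable_siz.
by apply: measurable_drain => //; apply: msnd; exact: measurable_gap.
Qed.

Lemma measurable_epoch m : measurable_fun setT (epoch D m).
Proof. by apply: measurable_sum => i; exact: measurable_gap. Qed.

Lemma epochS m o : epoch D m.+1 o = epoch D m o + gap D m o.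
Proof. by rewrite /epoch big_ord_recr. Qed.

Lemma epoch_le m m' o : (m <= m')%N -> epoch D m o <= epoch D m' o.
Proof.
elim: m' => [|m' IH]; first by rewrite leqn0 => /eqP->.
rewrite leq_eqVlt => /orP[/eqP->//|]; rewrite ltnS => /IH h.
by rewrite epochS (le_trans h)// lerDl ltW// gap_gt0.
Qed.

(** Positive gaps make the epochs increase, so at most one index satisfies the defining
    condition. *)
Lemma num_arrivalsE t m o : epoch D m o <= t < epoch D m.+1 o ->
  num_arrivals D t o = m.
Proof.
move=> h; apply: xget_unique => //= m' /andP[h1' h2'].
move: h => /andP[h1 h2]; apply/eqP; rewrite eqn_leq; apply/andP; split.
  rewrite leqNgt; apply/negP => /(epoch_le o) h.
  by have := lt_le_trans h2 (le_trans h h1'); rewrite ltxx.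
rewrite leqNgt; apply/negP => /(epoch_le o) h.
by have := lt_le_trans h2' (le_trans h h1); rewrite ltxx.
Qed.

Lemma measurable_num_arrivals t m : measurable [set o | num_arrivals D t o = m].
Proof.
pose B i := [set o | epoch D i o <= t < epoch D i.+1 o].
have mB i : measurable (B i).
  rewrite (_ : B i = (setT `&` (fun o => epoch D i o <= t) @^-1` [set true]) `&`
     (setT `&` (fun o => t < epoch D i.+1 o) @^-1` [set true])); last first.
    apply/seteqP; split => o; first by case/andP.
    by case=> [[_ h1] [_ h2]]; apply/andP; split.
  apply: measurableI.
    by apply: measurable_fun_ler => //; exact: measurable_epoch.
  by apply: measurable_fun_ltr => //; exact: measurable_epoch.
case: m => [|m].
  (* The value 0 is also the default of [xget], taken where no interval between epochs contains
     [t]. *)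
  rewrite (_ : [set o | _] = B 0%N `|` ~` \bigcup_i B i).
    apply: measurableU => //; apply: measurableC; exact: bigcupT_measurable.
  apply/seteqP; split => [y h|y [/num_arrivalsE//|h]].
    have [[i _ Bi]|] := pselect ((\bigcup_i B i) y); last by right.
    by left; have := num_arrivalsE Bi; rewrite h => i0; rewrite i0.
  by rewrite /= /num_arrivals xgetPN// => i Bi; apply: h; exists i.
rewrite (_ : [set o | _] = B m.+1)//.
apply/seteqP; split => [y h|y /num_arrivalsE//].
move: h; rewrite /= /num_arrivals; case: xgetP => // i -> /= Bi im.
by rewrite im in Bi.
Qed.

Lemma measurable_workload t :
  measurable_fun setT (fun x : n.-tuple R * O => workload k D x.1 t x.2).
Proof.
rewrite /workload.
apply: (@measurable_fun_case _ _ _ _ _ (fun x => num_arrivals D t x.2)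
  (fun m x => drain (after_arrivals k D x.1 m x.2) (t - epoch D m x.2))).
  move=> m; rewrite -[X in measurable X]setTI.
  exact: (@measurable_snd _ _ _ _ measurableT _ (measurable_num_arrivals t m)).
move=> m; apply: measurable_drain; first exact: measurable_after_arrivals.
apply: measurable_funB => //.
apply: (measurableT_comp (measurable_epoch m)); exact: measurable_snd.
Qed.

End measurable_model.

(** * Stationarity and the first arrival *)

Section marks.
Context {R : realType} {J : finType} (d : J -> nat)
  (F : forall j, probability ((d j).-tuple R) R).
Context (n : nat) (rate : R) (p : J -> R) (dO : measure_display)
  (O : measurableType dO) (P : probability O R).
Variable D : arrivals (n := n) F rate p P.
Hypothesis p0 : forall j, 0 <= p j.
Hypothesis p1 : \sum_j p j = 1.
Hypothesis d_n : forall j, (d j <= n)%N.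

(** The finite part of the description of a job, class and servers; the type of the sizes depends on
    it. *)
Definition mark := {j : J & {ffun 'I_(d j) -> 'I_n}}.

Definition mark_weight (i : mark) : R :=
  p (tag i) * (if injectiveb (tagged i) then (n ^_ d (tag i))%:R^-1 else 0).

Lemma mark_weight_ge0 i : 0 <= mark_weight i.
Proof. by rewrite mulr_ge0//; case: ifPn => // _; rewrite invr_ge0. Qed.

Lemma sum_markE (G : forall j, {ffun 'I_(d j) -> 'I_n} -> R) :
  \sum_(i : mark) mark_weight i * G (tag i) (tagged i) =
  \sum_j p j * ((n ^_ d j)%:R^-1 *
    \sum_(s : {ffun 'I_(d j) -> 'I_n} | injectiveb s) G j s).
Proof.
rewrite /mark_weight.
rewrite -(@sig_big_dep _ _ _ _ (fun j => {ffun 'I_(d j) -> 'I_n}) predT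
  (fun j => predT) (fun j (s : {ffun 'I_(d j) -> 'I_n}) =>
  p j * (if injectiveb s then (n ^_ d j)%:R^-1 else 0) * G j s))/=.
apply: eq_bigr => j _; rewrite mulr_sumr mulr_sumr [RHS]big_mkcond/=.
by apply: eq_bigr => s _; case: ifPn => _; rewrite ?mulr0 ?mul0r// mulrA.
Qed.

Lemma sum_mark_weight : \sum_i mark_weight i = 1.
Proof.
rewrite -p1 -(eq_bigr _ (fun i _ => mulr1 (mark_weight i))).
rewrite (sum_markE (fun _ _ => 1)); apply: eq_bigr => j _.
rewrite sumr_const.
by rewrite card_inj mulVf ?mulr1// pnatr_eq0 -lt0n ffact_gt0.
Qed.

Definition mark_of m o : mark :=
  Tagged (fun j => {ffun 'I_(d j) -> 'I_n}) (sel D m (cls D m o) o).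

Lemma mark_ofE m i : [set o | mark_of m o = i] =
  [set o | cls D m o = tag i] `&` [set o | sel D m (tag i) o = tagged i].
Proof.
apply/seteqP; split => y /=; first by move=> <-.
by case: i => j s /= [cj <-]; rewrite -cj.
Qed.

Lemma measurable_mark_of m i : measurable [set o | mark_of m o = i].
Proof.
by rewrite mark_ofE; apply: measurableI; [exact: measurable_cls|exact: measurable_sel].
Qed.

Lemma law_mark B i A : measurable B -> measurable A ->
  P ([set o | B (gap D 0 o) /\ mark_of 0 o = i] `&` siz D 0 (tag i) @^-1` A) =
  (exponential_prob rate B * (mark_weight i)%:E * F (tag i) A)%E.
Proof.
move=> mB mA.
have := @arrivals_law _ _ _ _ _ _ _ _ _ _ D 1 (fun=> B) (fun=> tag i)
  (fun=> tagged i) (fun=> A) (fun=> mB) (fun=> mA).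
rewrite big_ord1 /mark_weight EFinM muleA => <-.
congr (P _); apply/seteqP; split => y.
  move=> [[By my] Ay] [|//] _; have : [set o | mark_of 0 o = i] y by [].
  by rewrite mark_ofE => -[/= -> ->].
move=> /(_ 0%N isT)[By cy sy Ay]; split => //; split => //.
by rewrite -[_ = i]/([set o | mark_of 0 o = i] y) mark_ofE.
Qed.


Lemma integral_marks m (g : O -> \bar R) : measurable_fun setT g ->
  (forall o, 0 <= g o)%E ->
  (\int[P]_o g o = \sum_(i : mark) \int[P]_(o in [set o | mark_of m o = i]) g o)%E.
Proof.
move=> mg g0.
transitivity (\int[P]_o (\sum_(i : mark) (g \_ [set o | mark_of m o = i]) o))%E.
  apply: eq_integral => o _; rewrite (bigD1 (mark_of m o))//= big1 ?adde0.
    by rewrite patchE mem_set.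
  by move=> i ni; rewrite patchE memNset//= => mi; rewrite mi eqxx in ni.
rewrite ge0_integral_sum//.
- by apply: eq_bigr => i _; rewrite [RHS]integral_mkcond.
- move=> i; apply/(measurable_restrictT _ _).1; first exact: measurable_mark_of.
  exact: measurable_funTS.
- by move=> i o _; exact: erestrict_ge0.
Qed.

Lemma measure_marks m A : measurable A ->
  P A = (\sum_(i : mark) P (A `&` [set o | mark_of m o = i]))%E.
Proof.
move=> mA; rewrite -[A in LHS]setIT -integral_indic// (integral_marks m)//.
  apply: eq_bigr => i _; rewrite integral_indic//; exact: measurable_mark_of.
by apply/measurable_EFinP; exact: measurable_indic.
Qed.

Variables (B : set R) (th : R).
Hypotheses (mB : measurable B) (expB : exponential_prob rate B = th%:E) (th0 : 0 <= th).

Let mgap m : measurable (gap D m @^-1` B).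
Proof. by rewrite -[X in measurable X]setTI; exact: measurable_gap. Qed.

(** The first gap is independent of the first job. Splitting on the finitely many marks fixes the
    type of the sizes, and [integral_slice] applies to each piece. *)
Lemma integral_mark (h : forall i : mark, (d (tag i)).-tuple R -> \bar R) :
  (forall i, measurable_fun setT (h i)) ->
  (forall i xi, 0 <= h i xi)%E ->
  (\int[P]_(o in gap D 0 @^-1` B) h (mark_of 0 o) (siz D 0 (tag (mark_of 0 o)) o) =
  th%:E * \sum_(i : mark) (mark_weight i)%:E * \int[F (tag i)]_xi h i xi)%E.
Proof.
move=> mh h0.
rewrite integral_mkcond (integral_marks 0); last 2 first.
- apply/(measurable_restrictT _ (mgap 0)).1; apply: measurable_funTS.
  apply: (@measurable_fun_case _ _ _ _ _ (mark_of 0)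
    (fun i o => h i (siz D 0 (tag i) o))).
    by move=> i; exact: measurable_mark_of.
  move=> i; apply: (@measurableT_comp _ _ _ _ _ _ (h i) _ (siz D 0 (tag i))).
    exact: mh.
  exact: measurable_siz.
- by move=> o; exact: erestrict_ge0.
rewrite ge0_sume_distrr//; last first.
  by move=> i _; rewrite mule_ge0 ?lee_fin ?mark_weight_ge0// integral_ge0.
apply: eq_bigr => i _; rewrite -integral_mkcondl muleA -EFinM.
rewrite -(@integral_slice _ _ _ _ _ P (F (tag i))
  ([set o | B (gap D 0 o) /\ mark_of 0 o = i]) (siz D 0 (tag i)))//.
- by apply: eq_integral => o /[!inE] -[_ /= mi]; case: _ / mi.
- by apply: measurableI => //; [exact: mgap|exact: measurable_mark_of].
- exact: measurable_siz.
- by rewrite mulr_ge0 ?mark_weight_ge0.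
- by move=> A mA; have := law_mark (i := i) mB mA; rewrite expB -EFinM.
- exact: mh.
Qed.

Lemma measure_gap0 : P (gap D 0 @^-1` B) = th%:E.
Proof.
have := @integral_mark (fun _ _ => 1%E) (fun _ => measurable_cst _) (fun _ _ => lee01).
rewrite integral_cst// mul1e => ->.
rewrite (eq_bigr (fun i => (mark_weight i)%:E)) ?sumEFin ?sum_mark_weight ?mule1//.
move=> i _; rewrite integral_cst// mul1e -[RHS]mule1; congr (_ * _)%E.
exact: probability_setT.
Qed.

Lemma law_mark2 i i' :
  P ((gap D 0 @^-1` B `&` gap D 1 @^-1` B) `&` [set o | mark_of 0 o = i]
     `&` [set o | mark_of 1 o = i']) =
  ((th * mark_weight i) * (th * mark_weight i'))%:E.
Proof.
(* Prescribed classes of the first two jobs, as a function of the index; values from index 2 on are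
   arbitrary. *)
pose jj m := if m is 0%N then tag i else tag i'.
pose ss m : {ffun 'I_(d (jj m)) -> 'I_n} :=
  match m with 0%N => tagged i | _ => tagged i' end.
have := @arrivals_law _ _ _ _ _ _ _ _ _ _ D 2 (fun=> B) jj ss
  (fun=> setT) (fun=> mB) (fun=> measurableT).
rewrite big_ord_recl big_ord1 /= !probability_setT !mule1 expB -!EFinM.
rewrite /mark_weight !mulrA => <-.
congr (P _); apply/seteqP; split => y; rewrite !mark_ofE.
  by move=> [[[B0 B1] [c0 s0]] [c1 s1]] [|[|//]] _.
move=> H; have /= [B0 c0 s0 _] := H 0%N isT; have /= [B1 c1 s1 _] := H 1%N isT.
by split.
Qed.

(** With [B] equal to [[0, t]], this event contains the arrival of two jobs by time [t]; its
    probability is of second order. *)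
Lemma measure_gap01 : P (gap D 0 @^-1` B `&` gap D 1 @^-1` B) = (th * th)%:E.
Proof.
have mI i : measurable
    ((gap D 0 @^-1` B `&` gap D 1 @^-1` B) `&` [set o | mark_of 0 o = i]).
  by apply: measurableI; [exact: measurableI|exact: measurable_mark_of].
rewrite (measure_marks 0); last exact: measurableI.
transitivity (\sum_i (\sum_i' (th * mark_weight i) * (th * mark_weight i'))%:E)%E.
  apply: eq_bigr => i _; rewrite (measure_marks 1)// -sumEFin.
  by apply: eq_bigr => i' _; rewrite law_mark2.
rewrite sumEFin; congr EFin.
under eq_bigr do rewrite -mulr_sumr -mulr_sumr sum_mark_weight mulr1.
by rewrite -mulr_suml -mulr_sumr sum_mark_weight mulr1.
Qed.

End marks.

(** * Comparison of a stationary law with its image after one job *)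

Section one_step.
Context {R : realType} {J : finType} (k d : J -> nat)
  (F : forall j, probability ((d j).-tuple R) R).
Context (n : nat) (rate : R) (p : J -> R) (dO : measure_display)
  (O : measurableType dO) (P : probability O R).
Variable D : arrivals (n := n) F rate p P.
Hypothesis k_d : forall j, (1 <= k j <= d j)%N.
Hypothesis p0 : forall j, 0 <= p j.
Hypothesis p1 : \sum_j p j = 1.
Hypothesis d_n : forall j, (d j <= n)%N.
Hypothesis rate0 : 0 < rate.
Variable mu : probability (n.-tuple R) R.
Hypothesis mu_stationary : stationary k D mu.

(** Mean of [f] immediately after a job arriving in state [w]; no time passes, so the arrival rate
    does not enter. *)
Definition mean_after (f : n.-tuple R -> R) (w : n.-tuple R) : \bar R :=
  (\sum_(i : mark d n) (mark_weight p i)%:E *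
    \int[F (tag i)]_xi (f (add_job (k (tag i)) (tagged i) xi w))%:E)%E.

Variables (f : n.-tuple R -> R) (K c : R).
Hypothesis mf : measurable_fun setT f.
Hypothesis f0 : forall w, 0 <= f w.
Hypothesis fK : forall w, f w <= K.
Hypothesis c0 : 0 <= c.
Hypothesis f_drain : forall w t, 0 <= t -> f (drain w t) <= f w.
(** A drain just before the job may raise [f] after it; the cost [c * t] vanishes with [t]. *)
Hypothesis f_add_job : forall (w : n.-tuple R) t j (s : {ffun 'I_(d j) -> 'I_n}) xi,
  nonneg w -> 0 <= t ->
  f (add_job (k j) s xi (drain w t)) <= f (add_job (k j) s xi w) + c * t.

Let K0 : 0 <= K.
Proof. exact: le_trans (f0 (empty n)) (fK _). Qed.

Let mfE : measurable_fun setT (fun w => (f w)%:E).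
Proof. exact/measurable_EFinP. Qed.

Let mf_add_job (i : mark d n) : measurable_fun setT
  (fun x : n.-tuple R * (d (tag i)).-tuple R =>
   (f (add_job (k (tag i)) (tagged i) x.2 x.1))%:E).
Proof.
apply/measurable_EFinP; apply: (@measurableT_comp _ _ _ _ _ _ f) => //.
exact: measurable_add_job.
Qed.

Lemma mean_after_ge0 w : (0 <= mean_after f w)%E.
Proof.
apply: sume_ge0 => i _; rewrite mule_ge0 ?lee_fin ?mark_weight_ge0//.
by apply: integral_ge0 => xi _; rewrite lee_fin.
Qed.

Lemma measurable_mean_after : measurable_fun setT (mean_after f).
Proof.
apply: emeasurable_sum => i; apply: measurable_funeM.
apply: (@measurable_fun_fubini_tonelli_F _ _ _ _ _ (F (tag i)) _ (@mf_add_job i)).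
by move=> x; rewrite lee_fin.
Qed.

(** Invariance, given for sets, says that [mu] is the image of [mu \x P] under the workload at time
    [t]. *)
Lemma stationary_integral t : 0 <= t ->
  (\int[mu]_w (f w)%:E = \int[mu]_w \int[P]_o (f (workload k D w t o))%:E)%E.
Proof.
move=> t0; have mW := measurable_workload D k_d t.
pose W x := workload k D x.1 t x.2.
pose W' : {mfun _ >-> _} := HB.pack W (isMeasurableFun.Build _ _ _ _ _ mW).
rewrite -(@fubini_tonelli1 _ _ _ _ _ mu P (fun x => (f (W x))%:E)); last 2 first.
- by apply/measurable_EFinP; exact: (@measurableT_comp _ _ _ _ _ _ f).
- by move=> x; rewrite lee_fin.
transitivity (\int[pushforward (mu \x P)%E W']_w (f w)%:E)%E; last first.
  by rewrite ge0_integral_pushforward// => w _; rewrite lee_fin.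
apply: eq_measure_integral => A mA _; apply: (etrans (esym (mu_stationary.2 t A t0 mA))).
rewrite /pushforward/= /product_measure1; apply: eq_integral => w _ /=.
by rewrite xsectionE.
Qed.

(* If the first two gaps are both at most [t], the only bound used is [f <= K];
   this covers accumulating epochs, for which [num_arrivals] is a junk value. *)
Let pointwise t w y : 0 <= t ->
  f (workload k D w t y) + (if gap D 0 y <= t then f w else 0) <=
  f w + (if gap D 0 y <= t then
     f (add_job (k (cls D 0 y)) (sel D 0 (cls D 0 y) y) (siz D 0 (cls D 0 y) y) w)
     + c * t else 0) +
  (if (gap D 0 y <= t) && (gap D 1 y <= t) then K else 0) +
  (if `[< nonneg w >] then 0 else K).
Proof.
move=> t0; set a := f (add_job _ _ _ w).
have a0 : 0 <= a by exact: f0.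
have ct0 : 0 <= c * t by rewrite mulr_ge0.
have e0 : epoch D 0 y = 0 by rewrite /epoch big_ord0.
have e1 : epoch D 1 y = gap D 0 y by rewrite epochS e0 add0r.
have e2 : epoch D 2 y = gap D 0 y + gap D 1 y by rewrite epochS e1.
have K1 : 0 <= (if `[< nonneg w >] then 0 else K) by case: ifP.
have [g0|g0] := leP (gap D 0 y) t; last first.
  (* No arrival by time [t]: the workloads have only drained. *)
  rewrite !addr0 ler_wpDr// /workload (@num_arrivalsE _ _ _ _ _ _ _ _ _ _ D t 0 y).
    by apply: f_drain; rewrite e0 subr0.
  by rewrite e0 e1 t0.
have [g1|g1] /= := leP (gap D 1 y) t.
  move: (if `[< nonneg w >] then 0 else K) K1 (fK (workload k D w t y)) => b b0 h.
  by clearbody a; lra.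
have g0pos := gap_gt0 D 0 y.
(* Exactly one arrival by time [t]: drain, job, drain. A state that is not nonnegative falls back on
   [f <= K]. *)
rewrite addr0 [leLHS]addrC -!addrA lerD2l addrA /workload.
rewrite (@num_arrivalsE _ _ _ _ _ _ _ _ _ _ D t 1 y); last first.
  by rewrite e1 e2 g0/=; lra.
apply: (le_trans (f_drain _ _)); first by rewrite e1 subr_ge0.
case: ifPn => [/asboolP w0|_]; last by rewrite (le_trans (fK _))// lerDr addr_ge0.
rewrite addr0 /= (le_trans (f_add_job _ _ w0 (ltW g0pos)))//.
by rewrite lerD2l ler_wpM2l.
Qed.

Let mZ (t : R) : measurable (`[0, t]%classic : set R).
Proof. exact: measurable_itv. Qed.

Let gapE (t : R) m : gap D m @^-1` `[0, t]%classic = [set o | gap D m o <= t].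
Proof.
apply/seteqP; split => y /=; rewrite in_itv/=; first by case/andP.
by move=> ->; rewrite ltW ?gap_gt0.
Qed.

Let mgap t m : measurable [set o | gap D m o <= t].
Proof. by rewrite -gapE -[X in measurable X]setTI; exact: measurable_gap. Qed.

Let mnonneg : measurable (~` [set w : n.-tuple R | nonneg w]).
Proof. by apply: measurableC; exact: measurable_nonneg. Qed.

(** Expectation of [pointwise] over the arrivals: the first gap is at most [t] with probability
    [th], independently of the first job, and both gaps are with probability [th * th]. *)
Let integrated t th : 0 <= t -> 0 <= th ->
  exponential_prob rate `[0, t]%classic = th%:E ->
  forall w, (\int[P]_o (f (workload k D w t o))%:E + th%:E * (f w)%:E <=
    (f w)%:E + (th%:E * (mean_after f w + (c * t)%:E) + (K * (th * th))%:E) +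
    K%:E * (\1_(~` [set w | nonneg w]) w)%:E)%E.
Proof.
move=> t0 th0 thE w.
pose A m := [set o | gap D m o <= t].
pose h o := (f (add_job (k (tag (mark_of D 0 o))) (tagged (mark_of D 0 o))
  (siz D 0 (tag (mark_of D 0 o)) o) w))%:E.
have mh : measurable_fun setT h.
  apply: (@measurable_fun_case _ _ _ _ _ (mark_of D 0) (fun i o =>
    (f (add_job (k (tag i)) (tagged i) (siz D 0 (tag i) o) w))%:E)).
    by move=> i; exact: measurable_mark_of.
  move=> i; apply/measurable_EFinP; apply: (@measurableT_comp _ _ _ _ _ _ f) => //.
  by apply: measurable_add_job => //; exact: measurable_siz.
have h0 o : (0 <= h o)%E by rewrite lee_fin.
have ind0 m o : (0 <= (\1_(A m) o : R)%:E)%E by rewrite lee_fin.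
have mind m : measurable_fun setT (fun o => (\1_(A m) o : R)%:E).
  by apply/measurable_EFinP; apply: measurable_indic; exact: mgap.
have PA0 : (\int[P]_o (\1_(A 0%N) o)%:E = th%:E)%E.
  rewrite integral_indic//; last exact: mgap.
  rewrite setIT /A -gapE; exact: (measure_gap0 D p0 p1 d_n (mZ t) thE th0).
have mA01 : measurable (A 0%N `&` A 1%N) by apply: measurableI; exact: mgap.
have PA01 : (\int[P]_o (\1_(A 0%N `&` A 1%N) o)%:E = (th * th)%:E)%E.
  rewrite integral_indic// setIT /A -!gapE.
  by apply: measure_gap01 => //; exact: mZ.
have Ph : (\int[P]_o (h o * (\1_(A 0%N) o)%:E) = th%:E * mean_after f w)%E.
  transitivity (\int[P]_(o in A 0%N) h o)%E.
    rewrite [RHS]integral_mkcond; apply: eq_integral => o _.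
    by rewrite epatch_indic.
  rewrite /A -gapE.
  pose hh (i : mark d n) (xi : (d (tag i)).-tuple R) :=
    (f (add_job (k (tag i)) (tagged i) xi w))%:E.
  have E := @integral_mark _ _ _ _ _ _ _ _ _ _ D p0 _ _ (@mZ t) thE th0 hh.
  apply: E.
    move=> i; apply/measurable_EFinP; apply: (@measurableT_comp _ _ _ _ _ _ f) => //.
    exact: measurable_add_job.
  by move=> i xi; rewrite lee_fin.
pose g o := ((f (workload k D w t o))%:E + (f w)%:E * (\1_(A 0%N) o)%:E)%E.
pose g' o := ((f w)%:E + (h o * (\1_(A 0%N) o)%:E + (c * t)%:E * (\1_(A 0%N) o)%:E) +
  K%:E * (\1_(A 0%N `&` A 1%N) o)%:E + K%:E * (\1_(~` [set w | nonneg w]) w)%:E)%E.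
have mW : measurable_fun setT (fun o => (f (workload k D w t o))%:E).
  apply/measurable_EFinP; apply: (@measurableT_comp _ _ _ _ _ _ f) => //.
  exact: (measurable_fun_pair2 w (measurable_workload D k_d t)).
have mind01 : measurable_fun setT (fun o => (\1_(A 0%N `&` A 1%N) o : R)%:E).
  by apply/measurable_EFinP; exact: measurable_indic.
have mh1 : measurable_fun setT (fun o => h o * (\1_(A 0%N) o)%:E)%E.
  exact: emeasurable_funM.
have mc1 : measurable_fun setT (fun o => (c * t)%:E * (\1_(A 0%N) o)%:E)%E.
  exact: measurable_funeM.
have mK1 : measurable_fun setT (fun o => K%:E * (\1_(A 0%N `&` A 1%N) o)%:E)%E.
  exact: measurable_funeM.
have ct0 : 0 <= c * t by rewrite mulr_ge0.
have mS1 := emeasurable_funD mh1 mc1.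
have mS2 := emeasurable_funD (measurable_cst (f w)%:E) mS1.
have mS3 := emeasurable_funD mS2 mK1.
have mg' : measurable_fun setT g' by exact: emeasurable_funD.
have int_g : (\int[P]_o g o = \int[P]_o (f (workload k D w t o))%:E + th%:E * (f w)%:E)%E.
  rewrite ge0_integralD; last 5 first.
  - exact: measurableT.
  - by move=> o _; rewrite lee_fin.
  - exact: mW.
  - by move=> o _; rewrite mule_ge0 ?lee_fin.
  - exact: measurable_funeM.
  by rewrite ge0_integralZl ?lee_fin// PA0 muleC.
have int_g' : (\int[P]_o g' o =
    (f w)%:E + (th%:E * (mean_after f w + (c * t)%:E) + (K * (th * th))%:E) +
    K%:E * (\1_(~` [set w | nonneg w]) w)%:E)%E.
  have ge1 o : (0 <= h o * (\1_(A 0%N) o)%:E)%E by rewrite mule_ge0.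
  have ge2 o : (0 <= (c * t)%:E * (\1_(A 0%N) o)%:E)%E by rewrite mule_ge0.
  have ge3 o : (0 <= K%:E * (\1_(A 0%N `&` A 1%N) o)%:E)%E.
    by rewrite mule_ge0 ?lee_fin.
  have fw0 : (0 <= (f w)%:E)%E by rewrite lee_fin.
  rewrite ge0_integralD; last 5 first.
  - exact: measurableT.
  - by move=> o _; rewrite !adde_ge0.
  - exact: mS3.
  - by move=> o _; rewrite mule_ge0 ?lee_fin.
  - exact: measurable_cst.
  rewrite probability_integral_cst; congr (_ + _)%E.
  rewrite ge0_integralD; last 5 first.
  - exact: measurableT.
  - by move=> o _; rewrite !adde_ge0.
  - exact: mS2.
  - by [].
  - exact: mK1.
  rewrite ge0_integralZl ?lee_fin// PA01 -EFinM addeA; congr (_ + _)%E.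
  rewrite ge0_integralD; last 5 first.
  - exact: measurableT.
  - by [].
  - exact: measurable_cst.
  - by move=> o _; rewrite adde_ge0.
  - exact: mS1.
  rewrite probability_integral_cst; congr (_ + _)%E.
  rewrite ge0_integralD; last 5 first.
  - exact: measurableT.
  - by [].
  - exact: mh1.
  - by [].
  - exact: mc1.
  rewrite Ph ge0_integralZl ?lee_fin// PA0 ge0_muleDr ?mean_after_ge0 ?lee_fin//.
  by rewrite [in RHS](muleC th%:E (c * t)%:E).
rewrite -int_g -int_g'; apply: ge0_le_integral => //.
- by move=> o _; rewrite adde_ge0 ?mule_ge0 ?lee_fin.
- by apply: emeasurable_funD => //; exact: measurable_funeM.
move=> o _; rewrite /g /g' /h -!EFinM -!EFinD lee_fin.
have := pointwise w o t0; rewrite !indicE /A in_setI in_setC.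
have mA' m : (o \in [set y | gap D m y <= t]) = (gap D m o <= t).
  by apply/idP/idP; rewrite inE.
have mw : (w \in [set w | nonneg w]) = `[< nonneg w >].
  by apply/idP/asboolP; rewrite inE.
rewrite !mA' mw; case: (gap D 0 o <= t); case: (gap D 1 o <= t);
  case: `[< nonneg w >] => /=; rewrite ?mulr1 ?mulr0 ?addr0//.
Qed.

Let stationary_le_t t th : 0 <= t -> 0 < th ->
    exponential_prob rate `[0, t]%classic = th%:E ->
  (\int[mu]_w (f w)%:E <=
     \int[mu]_w mean_after f w + (c * t)%:E + (K * th)%:E)%E.
Proof.
move=> t0 th0 thE.
have th0' := ltW th0.
have ct0 : 0 <= c * t by rewrite mulr_ge0.
have f_ge0 w : (0 <= (f w)%:E)%E by rewrite lee_fin.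
have intf_ge0 : (0 <= \int[mu]_w (f w)%:E)%E by exact: integral_ge0.
have intfK : (\int[mu]_w (f w)%:E <= K%:E)%E.
  rewrite -(probability_integral_cst mu K); apply: ge0_le_integral => //.
  by move=> w _; rewrite lee_fin.
have intf_fin : (\int[mu]_w (f w)%:E \is a fin_num)%E.
  by rewrite ge0_fin_numE// (le_lt_trans intfK)// ltry.
pose u w := (\int[P]_o (f (workload k D w t o))%:E)%E.
have u0 w : (0 <= u w)%E by apply: integral_ge0 => o _; rewrite lee_fin.
have mu' : measurable_fun setT u.
  apply: (@measurable_fun_fubini_tonelli_F _ _ _ _ _ P
    (fun x => (f (workload k D x.1 t x.2))%:E)).
    apply/measurable_EFinP; apply: (@measurableT_comp _ _ _ _ _ _ f) => //.
    exact: measurable_workload.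
  by move=> x; rewrite lee_fin.
pose a w := (mean_after f w + (c * t + K * th)%:E)%E.
have a0 w : (0 <= a w)%E.
  by rewrite adde_ge0 ?mean_after_ge0// lee_fin addr_ge0// mulr_ge0.
have ma : measurable_fun setT a.
  by apply: emeasurable_funD => //; exact: measurable_mean_after.
pose b (w : n.-tuple R) : \bar R := (K%:E * (\1_(~` [set w | nonneg w]) w)%:E)%E.
have b0 w : (0 <= b w)%E by rewrite mule_ge0 ?lee_fin.
have mb : measurable_fun setT b.
  by apply: measurable_funeM; apply/measurable_EFinP; exact: measurable_indic.
(* [mu] charges only nonnegative states, so the correction term vanishes. *)
have intb : (\int[mu]_w b w = 0)%E.
  have mi : measurable_fun setT
      (fun w : n.-tuple R => (\1_(~` [set w | nonneg w]) w : R)%:E).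
    by apply/measurable_EFinP; exact: measurable_indic.
  have i0 (w : n.-tuple R) : setT w ->
      (0 <= (\1_(~` [set w | nonneg w]) w : R)%:E)%E by rewrite lee_fin.
  rewrite ge0_integralZl ?lee_fin// integral_indic// setIT.
  suff h : mu (~` [set w | nonneg w]) = 0%E.
    by apply: etrans (congr1 (fun z => K%:E * z)%E h) _; rewrite mule0.
  rewrite probability_setC; last exact: measurable_nonneg.
  by rewrite mu_stationary.1 subee.
have main w : (u w + th%:E * (f w)%:E <= (f w)%:E + th%:E * a w + b w)%E.
  apply: (le_trans (integrated t0 th0' thE w)).
  rewrite leeD2r// leeD2l// /a EFinD.
  rewrite !ge0_muleDr ?adde_ge0 ?mean_after_ge0 ?lee_fin ?mulr_ge0//.
  by rewrite -addeA leeD2l// leeD2l// -EFinM (mulrCA th).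
have : (\int[mu]_w (u w + th%:E * (f w)%:E) <=
        \int[mu]_w ((f w)%:E + th%:E * a w + b w))%E.
  apply: ge0_le_integral => //.
  - by move=> w _; rewrite adde_ge0// mule_ge0 ?lee_fin.
  - by apply: emeasurable_funD => //; exact: measurable_funeM.
  - apply: emeasurable_funD => //; apply: emeasurable_funD => //.
    exact: measurable_funeM.
have mthf : measurable_fun setT (fun w => th%:E * (f w)%:E)%E by exact: measurable_funeM.
have mtha : measurable_fun setT (fun w => th%:E * a w)%E by exact: measurable_funeM.
have thf0 w : (0 <= th%:E * (f w)%:E)%E by rewrite mule_ge0 ?lee_fin.
have tha0 w : (0 <= th%:E * a w)%E by rewrite mule_ge0 ?lee_fin.
rewrite ge0_integralD//.
rewrite [X in (_ <= X)%E -> _]ge0_integralD//; last 2 first.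
  by move=> w _; rewrite adde_ge0.
  by apply: emeasurable_funD.
rewrite intb adde0 [X in (_ <= X)%E -> _]ge0_integralD//.
(* By stationarity the mean of [f] appears on both sides; it is finite because [f <= K], so it
   cancels. Division by [th] follows. *)
rewrite -stationary_integral// leeD2lE//.
rewrite !ge0_integralZl//.
rewrite lee_pmul2l// => /le_trans; apply.
rewrite ge0_integralD//; last 3 first.
- by move=> w _; exact: mean_after_ge0.
- exact: measurable_mean_after.
- by move=> w _; rewrite lee_fin addr_ge0// mulr_ge0.
by rewrite probability_integral_cst EFinD addeA.
Qed.

Lemma stationary_le :
  (\int[mu]_w (f w)%:E <= \int[mu]_w mean_after f w)%E.
Proof.
apply/lee_addgt0Pr => e e0.
have s0 : 0 < c + K * rate + 1.
  by rewrite ltr_wpDl// addr_ge0// mulr_ge0// ltW.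
(* With [th <= rate * t], the two errors [c * t] and [K * th] together are at most [e]; the [+ 1]
   keeps the denominator positive. *)
pose t := e / (c + K * rate + 1).
have t0 : 0 < t by rewrite divr_gt0.
have thE : exponential_prob rate `[0, t]%classic = (1 - expR (- rate * t))%:E.
  by rewrite exponential_prob_itv0c// EFinB.
have th0 : 0 < 1 - expR (- rate * t).
  by rewrite subr_gt0 expR_lt1 mulNr oppr_lt0 mulr_gt0.
apply: (le_trans (stationary_le_t (ltW t0) th0 thE)).
rewrite -addeA leeD2l// -EFinD lee_fin.
have thle : 1 - expR (- rate * t) <= rate * t.
  by have := expR_ge1Dx (- rate * t); rewrite mulNr; lra.
apply: (@le_trans _ _ (t * (c + K * rate + 1))); last by rewrite /t divfK// gt_eqF.
have := ler_wpM2l K0 thle; lra.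
Qed.

End one_step.

(** * Drift *)

Section sizes.
Context {R : realType} {d : nat} (k : nat) (F : probability (d.-tuple R) R).
Hypothesis k_d : (1 <= k <= d)%N.
Hypothesis F_nonneg : F [set xi | nonneg xi] = 1%E.

Lemma measurable_kth_smallest_id :
  measurable_fun setT (fun xi : d.-tuple R => kth_smallest k xi).
Proof.
under eq_fun do rewrite kth_smallestE.
by apply: measurable_kth_smallest => // a; exact: measurable_tnth.
Qed.

Lemma negligible_negative : F.-negligible (~` [set xi | nonneg xi]).
Proof.
exists (~` [set xi | nonneg xi]); split.
- by apply: measurableC; exact: measurable_nonneg.
- rewrite probability_setC; last exact: measurable_nonneg.
  by rewrite F_nonneg subee.
- by [].
Qed.

Lemma measurable_spread_sizes (D e : R) :
  measurable_fun setT (fun xi : d.-tuple R => spread_sizes k xi D e).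
Proof.
have mt a := @measurable_tnth _ R d a.
apply: measurable_and.
  apply: (measurable_fun_bool true).
  rewrite (_ : _ @^-1` _ = \bigcap_(a : 'I_d) [set xi : d.-tuple R | tnth xi a <= D]).
    rewrite setTI.
    apply: fin_bigcap_measurable => // a _; rewrite -[X in measurable X]setTI.
    by apply: (@measurable_fun_ler _ _ _ _ (fun w : d.-tuple R => tnth w a) (cst D)).
  apply/seteqP; split => [xi /= /forallP h a _ /=|xi h /=]; first exact: h.
  by apply/forallP => a; exact: h.
apply: (measurable_fun_bool true).
rewrite (_ : _ @^-1` _ = \bigcup_(a : 'I_d)
    [set xi : d.-tuple R | kth_smallest k xi + e <= tnth xi a]).
  rewrite setTI.
  apply: countable_bigcupT_measurable => // a; rewrite -[X in measurable X]setTI.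
  apply: (@measurable_fun_ler _ _ _ _ (fun w : d.-tuple R => _)
    (fun w : d.-tuple R => tnth w a)) => //.
  by apply: measurable_funD => //; exact: measurable_kth_smallest_id.
apply/seteqP; split => [xi /existsP[a xia]|xi [a _ xia]]; first by exists a.
by apply/existsP; exists a.
Qed.

Lemma measurable_large_sizes (D e : R) :
  measurable_fun setT (fun xi : d.-tuple R => large_sizes k xi D e).
Proof.
have mt a := @measurable_tnth _ R d a.
apply: measurable_and.
  apply: (measurable_fun_bool true).
  rewrite (_ : _ @^-1` _ = \bigcap_(a : 'I_d) [set xi : d.-tuple R | tnth xi a <= D]).
    rewrite setTI.
    apply: fin_bigcap_measurable => // a _; rewrite -[X in measurable X]setTI.
    by apply: (@measurable_fun_ler _ _ _ _ (fun w : d.-tuple R => tnth w a) (cst D)).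
  apply/seteqP; split => [xi /= /forallP h a _ /=|xi h /=]; first exact: h.
  by apply/forallP => a; exact: h.
by apply: measurable_fun_ler => //; exact: measurable_kth_smallest_id.
Qed.

Let eventually_bounded (xi : d.-tuple R) (y : R) : 0 < y ->
  exists N : nat, (forall a, tnth xi a <= N%:R) /\ N.+1%:R^-1 <= y.
Proof.
move=> y0.
(* One integer above [M] bounds every size, and its successor has inverse below [y]. *)
pose M := \sum_a `|tnth xi a| + y^-1.
have M0 : 0 <= M by apply: addr_ge0; [exact: sumr_ge0|rewrite invr_ge0 ltW].
exists (Num.trunc M).+1; split.
  move=> a; rewrite (le_trans (ler_norm _))//.
  apply: (@le_trans _ _ M); last by rewrite ltW// truncnS_gt.
  rewrite /M (bigD1 a)//= -addrA lerDl; apply: addr_ge0; first exact: sumr_ge0.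
  by rewrite invr_ge0 ltW.
rewrite invf_ple ?posrE// (@le_trans _ _ M)//.
  by rewrite /M lerDr sumr_ge0.
by rewrite (le_trans (ltW (truncnS_gt M)))// ler_nat.
Qed.

(** As [Q] increases, the alternative is that every [Q N] is null. Their union would then be null,
    and it covers [E] up to tuples with a negative entry, which are null too. *)
Let eventually_pos (E : set (d.-tuple R)) (Q : nat -> set (d.-tuple R)) :
  measurable E -> (forall N, measurable (Q N)) ->
  (forall N N', (N <= N')%N -> Q N `<=` Q N') ->
  (forall xi, E xi -> nonneg xi -> exists N, Q N xi) -> (0 < F E)%E ->
  exists N0, forall N, (N0 <= N)%N -> (0 < F (Q N))%E.
Proof.
move=> mE mQ ndQ EQ FE; apply: contrapT => noN.
have Q0 N : F (Q N) = 0%E.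
  apply/eqP; rewrite -measure_le0 leNgt; apply/negP => h; apply: noN.
  exists N => N' NN'; apply: (lt_le_trans h); apply: le_measure; rewrite ?inE//.
  exact: ndQ.
have : F.-negligible (\bigcup_N Q N).
  apply: negligible_bigcup => N; apply/(negligibleP F (mQ N)).
  exact: Q0.
move=> /(negligibleU negligible_negative) /negligibleS => /(_ E) h.
have /negligibleP : F.-negligible E.
  apply: h => xi Exi; have [xi0|xi0] := pselect (nonneg xi); last by left.
  by right; have [N QN] := EQ _ Exi xi0; exists N.
by move=> /(_ mE) E0; rewrite E0 ltxx in FE.
Qed.

Let msetb (b : d.-tuple R -> bool) : measurable_fun setT b -> measurable [set xi | b xi].
Proof.
move=> mb; rewrite -[X in measurable X]setTI.
exact: (mb measurableT [set true]).
Qed.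

Lemma spread_sizes_pos :
  (0 < F [set xi | (0 < \big[Num.max/0]_(a < d) tnth xi a - kth_smallest k xi)%R])%E ->
  exists N0, forall N, (N0 <= N)%N ->
    (0 < F [set xi | spread_sizes k xi N%:R N.+1%:R^-1])%E.
Proof.
apply: eventually_pos.
(* The maximum starts from 0, hence the additional case of a negative [k]-th smallest entry. *)
- rewrite (_ : [set xi | _] = [set xi : d.-tuple R | (kth_smallest k xi < 0)%R] `|`
    \bigcup_(a : 'I_d) [set xi : d.-tuple R | (kth_smallest k xi < tnth xi a)%R]).
    apply: measurableU.
      apply: (@msetb (fun xi => _ < _)); apply: measurable_fun_ltr => //.
      exact: measurable_kth_smallest_id.
    apply: countable_bigcupT_measurable => // a.
    apply: (@msetb (fun xi => _ < _)); apply: measurable_fun_ltr => //.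
      exact: measurable_kth_smallest_id.
    exact: measurable_tnth.
  apply/seteqP; split => xi /=; rewrite subr_gt0.
    move=> h; apply: contrapT => /not_orP[/negP k0 ka].
    rewrite ltNge in h; move/negP: h; apply.
    apply/bigmax_leP; split; first by rewrite leNgt.
    by move=> a _; rewrite leNgt; apply/negP => xia; apply: ka; exists a.
  move=> h; rewrite ltNge; apply/negP => /bigmax_leP[k0 ka].
  by case: h => [|[a _ /=]]; rewrite ltNge ?k0// ka.
- by move=> N; apply: msetb; exact: measurable_spread_sizes.
- move=> N N' NN' xi /andP[/forallP xiN /existsP[a xia]]; apply/andP; split.
    by apply/forallP => b; rewrite (le_trans (xiN b))// ler_nat.
  apply/existsP; exists a; rewrite (le_trans _ xia)// lerD2l lef_pV2 ?posrE//.
  by rewrite ler_nat.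
- move=> xi /= h xi0.
  have [a ka] : exists a, kth_smallest k xi < tnth xi a.
    apply: contrapT => noa; move: h; rewrite subr_gt0 ltNge => /negP; apply.
    apply/bigmax_leP; split.
      rewrite kth_smallestE; exact: (kth_smallest_ge k_d).
    by move=> a _; rewrite leNgt; apply/negP => xia; apply: noa; exists a.
  have := ka; rewrite -subr_gt0 => /(eventually_bounded xi)[N [xiN Na]].
  exists N; apply/andP; split; first exact/forallP.
  by apply/existsP; exists a; rewrite -lerBrDl.
Qed.

Lemma large_sizes_pos : (F [set xi : d.-tuple R | (k <= count_mem 0%R xi)%N] < 1)%E ->
  exists N0, forall N, (N0 <= N)%N ->
    (0 < F [set xi | large_sizes k xi N%:R N.+1%:R^-1])%E.
Proof.
(* Absolute values make having [k] zero entries equivalent to [K xi <= 0] for every tuple, signed or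
   not. *)
pose K (xi : d.-tuple R) := kth_smallest k [tuple `|tnth xi a| | a < d].
have KE (xi : d.-tuple R) : (k <= count_mem 0%R xi)%N = (K xi <= 0).
  rewrite /K (kth_smallest_le k_d) cardsE cardE size_filter -enumT.
  rewrite -[in LHS](map_tnth_enum xi) count_map; congr (_ <= _)%N.
  by apply: eq_count => a /=; rewrite -normr_le0.
have mK : measurable_fun setT K.
  apply: measurable_kth_smallest => // a; apply: measurableT_comp => //.
  exact: measurable_tnth.
move=> F1; apply: (@eventually_pos [set xi | 0 < K xi]).
- by apply: (@msetb (fun xi => _ < _)); exact: measurable_fun_ltr.
- by move=> N; apply: msetb; exact: measurable_large_sizes.
- move=> N N' NN' xi /andP[/forallP xiN ka]; apply/andP; split.
    by apply/forallP => b; rewrite (le_trans (xiN b))// ler_nat.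
  by rewrite (le_trans _ ka)// lef_pV2 ?posrE// ler_nat.
- move=> xi /= h xi0.
  have E : K xi = kth_smallest k xi.
    rewrite [RHS]kth_smallestE; congr kth_smallest; congr val.
    by apply: eq_mktuple => a; rewrite ger0_norm.
  rewrite E in h; have [N [xiN Na]] := eventually_bounded xi h.
  by exists N; apply/andP; split; first exact/forallP.
rewrite (_ : [set xi | _] = ~` [set xi : d.-tuple R | (k <= count_mem 0%R xi)%N]).
  rewrite probability_setC ?sube_gt0//.
  rewrite (_ : [set xi | _] = [set xi | K xi <= 0]); last first.
    by apply/seteqP; split => xi /=; rewrite KE.
  by apply: (@msetb (fun xi => _ <= _)); exact: measurable_fun_ler.
by apply/seteqP; split => xi /=; rewrite KE ltNge => /negP.
Qed.

Lemma second_moment_sum : exchangeable F -> (\int[F]_xi ((xi`_0) ^+ 2)%:E < +oo)%E ->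
  (\int[F]_xi (\sum_a tnth xi a ^+ 2)%:E < +oo)%E.
Proof.
move=> exF sm.
have d0 : (0 < d)%N by have := k_d; lia.
pose a0 := Ordinal d0.
have mt a : measurable_fun setT (fun xi : d.-tuple R => (tnth xi a ^+ 2)%:E).
  apply/measurable_EFinP; apply: measurable_funX; exact: measurable_tnth.
have E a : (\int[F]_xi (tnth xi a ^+ 2)%:E = \int[F]_xi ((xi`_0) ^+ 2)%:E)%E.
  (* Transposing slots 0 and [a] preserves [F], so all components have the second moment of the
     first. *)
  pose phi (xi : d.-tuple R) := [tuple tnth xi (tperm a0 a b) | b < d].
  have mphi : measurable_fun setT phi.
    apply/measurable_fun_tnthP => i; rewrite /comp/= /phi.
    by under eq_fun do rewrite tnth_mktuple; exact: measurable_tnth.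
  have := @integral_slice _ _ _ _ _ F F setT phi 1
    (fun xi => (tnth xi a0 ^+ 2)%:E) measurableT mphi ler01.
  rewrite mul1e => H; transitivity (\int[F]_xi (tnth (phi xi) a0 ^+ 2)%:E)%E.
    by apply: eq_integral => xi _; rewrite /phi tnth_mktuple tpermL.
  rewrite H//.
  - by apply: eq_integral => xi _; rewrite (tnth_nth 0).
  - by move=> A mA; rewrite setTI mul1e; exact: exF.
  - by move=> xi; rewrite lee_fin sqr_ge0.
under eq_integral do rewrite -sumEFin.
rewrite ge0_integral_sum//; last by move=> a xi _; rewrite lee_fin sqr_ge0.
under eq_bigr do rewrite E.
by apply: lte_sum_pinfty => a _.
Qed.

End sizes.

(** * Regularity of the truncated squared deviations *)

Section truncated_sqdev.
Context {R : realType} (n : nat).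
Hypothesis n0 : (0 < n)%N.
Implicit Types w : n.-tuple R.

Lemma measurable_mean dT (T : measurableType dT) (x : T -> 'I_n -> R) :
  (forall i, measurable_fun setT (x ^~ i)) -> measurable_fun setT (fun t => mean (x t)).
Proof.
move=> mx; apply: measurable_funM => //.
by apply: measurable_sum => i; exact: mx.
Qed.

Lemma measurable_sqdev dT (T : measurableType dT) (x : T -> 'I_n -> R) :
  (forall i, measurable_fun setT (x ^~ i)) -> measurable_fun setT (fun t => sqdev (x t)).
Proof.
move=> mx; apply: measurable_sum => i; apply: measurable_funX.
by apply: measurable_funB; [exact: mx|exact: measurable_mean].
Qed.

(** Draining is 1-Lipschitz in each coordinate, so it shrinks all pairwise differences. *)
Lemma sqdev_drain w t : 0 <= t -> sqdev (tnth (drain w t)) <= sqdev (tnth w).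
Proof.
move=> t0; apply: sqdev_lipschitz => // i l; rewrite !tnth_mktuple.
rewrite ler_norml; have := ler_norm (tnth w i - tnth w l).
have := ler_norm (- (tnth w i - tnth w l)); rewrite normrN.
move: `|_| => N h1 h2; rewrite /Num.max.
by case: ifPn; case: ifPn; rewrite -?leNgt => h3 h4; apply/andP; split; lra.
Qed.

(** In [sqdev_shift], with [a = x i - mean x], the linear terms are at most [2 |a| t <= (a^2 + 1) t]
    and the quadratic ones at most [t^2 <= t]. *)
Lemma sqdev_close (x y : 'I_n -> R) t : 0 <= t <= 1 ->
  (forall i, `|y i - x i| <= t) ->
  sqdev y <= sqdev x + (sqdev x + 2 * n%:R) * t.
Proof.
move=> /andP[t0 t1] xy; apply: (le_trans (sqdev_shift x y n0)).
rewrite -addrA lerD2l.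
have h1 : 2 * (\sum_i (x i - mean x) * (y i - x i)) <= (sqdev x + n%:R) * t.
  rewrite /sqdev -[n%:R]mulr1 -sum_const_ord -big_split/= mulr_suml mulr_sumr.
  apply: ler_sum => i _; have := xy i; rewrite ler_norml => /andP[h1 h2].
  set a := x i - mean x; set b := y i - x i in h1 h2 *.
  have e1 : 0 <= (a - 1) ^+ 2 by exact: sqr_ge0.
  have e2 : 0 <= (a + 1) ^+ 2 by exact: sqr_ge0.
  have e3 : 0 <= a ^+ 2 by exact: sqr_ge0.
  have [a0|a0] := leP 0 a; nra.
have h2 : \sum_i (y i - x i) ^+ 2 <= n%:R * t.
  rewrite -sum_const_ord; apply: ler_sum => i _.
  have := xy i; rewrite ler_norml => /andP[g1 g2].
  set b := y i - x i in g1 g2 *; nra.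
by apply: (le_trans (lerD h1 h2)); lra.
Qed.

Variable d k : nat.
Hypothesis k_d : (1 <= k <= d)%N.

(** Draining lowers each workload, hence the completion time, by at most [t]. The new workload is
    monotone in both and commutes with common shifts. *)
Lemma add_job_close w t (s : {ffun 'I_d -> 'I_n}) (xi : d.-tuple R) i :
  nonneg w -> 0 <= t ->
  `|tnth (add_job k s xi (drain w t)) i - tnth (add_job k s xi w) i| <= t.
Proof.
move=> w0 t0; have dr l : tnth (drain w t) l = Num.max 0 (tnth w l - t).
  by rewrite tnth_mktuple.
have dr1 l : tnth w l - t <= tnth (drain w t) l by rewrite dr le_max lexx orbT.
have dr2 l : tnth (drain w t) l <= tnth w l.
  by rewrite dr ge_max w0 gerBl.
rewrite /add_job !(tnth_mktuple _ i) -?dr.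
case: pickP => [a _|_]; last first.
  by have := dr1 i; have := dr2 i => h1 h2; rewrite ler_norml; apply/andP; split; lra.
have T1 : kth_smallest k [tuple tnth (drain w t) (s a) + tnth xi a | a < d] <=
    kth_smallest k [tuple tnth w (s a) + tnth xi a | a < d].
  rewrite (kth_smallest_le k_d).
  have := lexx (kth_smallest k [tuple tnth w (s a) + tnth xi a | a < d]).
  rewrite {1}(kth_smallest_le k_d) => kT; apply: (leq_trans kT).
  apply: subset_leq_card; apply/fintype.subsetP => b.
  by rewrite !inE; apply: le_trans; rewrite lerD2r.
have T2 : kth_smallest k [tuple tnth w (s a) + tnth xi a | a < d] <=
    kth_smallest k [tuple tnth (drain w t) (s a) + tnth xi a | a < d] + t.
  rewrite (kth_smallest_le k_d).
  have := lexx (kth_smallest k [tuple tnth (drain w t) (s a) + tnth xi a | a < d]).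
  rewrite {1}(kth_smallest_le k_d) => kT; apply: (leq_trans kT).
  apply: subset_leq_card; apply/fintype.subsetP => b.
  by rewrite !inE => h; have := dr1 (s b); lra.
move: T1 T2; set T' := kth_smallest _ _; set T := kth_smallest _ _ => T1 T2.
have := dr1 i; have := dr2 i.
move: (tnth (drain w t) i) (tnth w i) (tnth xi a) => x y z h1 h2.
have A : Num.max x (Num.min (x + z) T') <= Num.max y (Num.min (y + z) T).
  by rewrite ge_max !le_max !le_min !ge_min h1 lerD2r h1 T1 !orbT.
have B : Num.max y (Num.min (y + z) T) - t <= Num.max x (Num.min (x + z) T').
  rewrite lerBlDr addr_maxl addr_minl ge_max !le_max !le_min !ge_min.
  by rewrite -lerBlDr h2/= T2 orbT andbT -orbA; apply/or3P; apply: Or33; lra.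
by rewrite ler_norml; apply/andP; split; lra.
Qed.

Variable K : R.
Hypothesis K0 : 0 <= K.

Definition trunc_sqdev w := Num.min (sqdev (tnth w)) K.

Lemma measurable_trunc_sqdev : measurable_fun setT trunc_sqdev.
Proof.
apply: measurable_minr => //; apply: measurable_sqdev => i.
exact: measurable_tnth.
Qed.

Lemma trunc_sqdev_ge0 w : 0 <= trunc_sqdev w.
Proof. by rewrite le_min sqdev_ge0. Qed.

Lemma trunc_sqdev_le w : trunc_sqdev w <= K.
Proof. by rewrite ge_min lexx orbT. Qed.

Lemma trunc_sqdev_drain w t : 0 <= t -> trunc_sqdev (drain w t) <= trunc_sqdev w.
Proof.
by move=> t0; rewrite le_min trunc_sqdev_le andbT ge_min sqdev_drain.
Qed.

(** Truncation makes the constant independent of the state: either the value after the job is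
    already [K], or [sqdev_close] applies with deviation below [K]; for [t > 1] one has
    [K <= K * t]. *)
Lemma trunc_sqdev_add_job w t (s : {ffun 'I_d -> 'I_n}) (xi : d.-tuple R) :
  nonneg w -> 0 <= t ->
  trunc_sqdev (add_job k s xi (drain w t)) <=
  trunc_sqdev (add_job k s xi w) + (K + 2 * n%:R) * t.
Proof.
move=> w0 t0; set y := add_job _ _ _ (drain _ _); set x := add_job _ _ _ w.
have n1 : 0 <= n%:R :> R by [].
have c0 : 0 <= (K + 2 * n%:R) * t by rewrite mulr_ge0// addr_ge0// mulr_ge0.
have [xK|xK] := leP K (sqdev (tnth x)).
  rewrite [X in _ <= X + _](_ : _ = K); last by apply/min_idPr.
  by rewrite (le_trans (trunc_sqdev_le _))// lerDl.
have -> : trunc_sqdev x = sqdev (tnth x) by apply/min_idPl; exact: ltW.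
have [t1|t1] := leP t 1.
  apply: (@le_trans _ _ (sqdev (tnth y))); first by rewrite ge_min lexx.
  apply: (le_trans (@sqdev_close (tnth x) (tnth y) t _ _)); first by rewrite t0.
    by move=> i; exact: add_job_close.
  by rewrite lerD2l ler_wpM2r// lerD2r ltW.
apply: (le_trans (trunc_sqdev_le _)).
apply: (@le_trans _ _ ((K + 2 * n%:R) * t)); last by rewrite lerDr sqdev_ge0.
have : K * 1 <= K * t by rewrite ler_wpM2l// ltW.
have : 0 <= 2 * n%:R * t by rewrite !mulr_ge0.
lra.
Qed.

End truncated_sqdev.

(** The constant of [avg_after_sqdev_strict] times [n], times the probability [g], times [1/2] for
    passing from the median to the mean. *)
Definition class_rate (R : realType) (d : nat) (e g : R) : R :=
  e * g / (4%:R ^+ d * (4 * d%:R)).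

Lemma class_rate_gt0 (R : realType) (d : nat) (e g : R) :
  (0 < d)%N -> 0 < e -> 0 < g -> 0 < class_rate d e g.
Proof.
by move=> d0 e0 g0; rewrite divr_gt0 ?mulr_gt0 ?exprn_gt0 ?ltr0n.
Qed.

(** * Mean drift over classes and sizes, uniformly in the number of servers *)

Section mean_drift.
Context {R : realType} {J : finType} (k d : J -> nat)
  (F : forall j, probability ((d j).-tuple R) R).
Hypothesis k_d : forall j, (1 <= k j <= d j)%N.
Hypothesis F_nonneg : forall j, F j [set xi | nonneg xi] = 1%E.
Variable S : J -> R.
Hypothesis SE : forall j, (\int[F j]_xi (\sum_a tnth xi a ^+ 2)%:E = (S j)%:E)%E.
Variable j0 : J.
Hypothesis kd0 : (k j0 < d j0)%N.
Variables (D e g q : R).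
Hypotheses (D0 : 0 <= D) (e0 : 0 < e) (g0 : 0 < g) (q0 : 0 < q).
Hypothesis spread0 : (g%:E <=
  F j0 [set xi : (d j0).-tuple R | spread_sizes (k j0) xi D e])%E.
Hypothesis large0 : (g%:E <=
  F j0 [set xi : (d j0).-tuple R | large_sizes (k j0) xi D e])%E.
Variables (n : nat) (p : J -> R).
Hypothesis d_n : forall j, (4 * d j <= n)%N.
Hypothesis p0 : forall j, 0 <= p j.
Hypothesis p1 : \sum_j p j = 1.
Hypothesis pq : q <= p j0.
Implicit Types w : n.-tuple R.

Let n0 : (0 < n)%N.
Proof.
have /andP[k0 kd] := k_d j0.
by rewrite (leq_trans _ (d_n j0))// muln_gt0/= (leq_trans k0).
Qed.

Let Fint_ge0 j (h : (d j).-tuple R -> R) : (forall xi, 0 <= h xi) ->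
  (0 <= \int[F j]_xi (h xi)%:E)%E.
Proof. by move=> h0; apply: integral_ge0 => xi _; rewrite lee_fin. Qed.

Lemma avg_after_ge0 j w (f : n.-tuple R -> R) : (forall w, 0 <= f w) ->
  forall xi : (d j).-tuple R, 0 <= avg_after (k j) xi w f.
Proof.
by move=> f0 xi; rewrite mulr_ge0 ?invr_ge0 ?sumr_ge0.
Qed.

Lemma measurable_avg_after j w (f : n.-tuple R -> R) : measurable_fun setT f ->
  measurable_fun setT (fun xi : (d j).-tuple R => avg_after (k j) xi w f).
Proof.
move=> mf; apply: measurable_funM => //.
under eq_fun do rewrite big_mkcond/=.
apply: measurable_sum => s; case: (injectiveb s) => //.
apply: (@measurableT_comp _ _ _ _ _ _ f) => //.
by apply: measurable_add_job => //; exact: measurable_id.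
Qed.

Lemma mean_afterE (f : n.-tuple R -> R) w : measurable_fun setT f ->
  (forall w, 0 <= f w) ->
  mean_after k F p f w =
  (\sum_j (p j)%:E * \int[F j]_xi (avg_after (k j) xi w f)%:E)%E.
Proof.
move=> mf f0; rewrite /mean_after.
have mfa j (s : {ffun 'I_(d j) -> 'I_n}) :
    measurable_fun setT (fun xi => (f (add_job (k j) s xi w))%:E).
  apply/measurable_EFinP; apply: (@measurableT_comp _ _ _ _ _ _ f) => //.
  by apply: measurable_add_job => //; exact: measurable_id.
rewrite -(@sig_big_dep _ _ _ _ (fun j => {ffun 'I_(d j) -> 'I_n}) predT
  (fun j => predT) (fun j (s : {ffun 'I_(d j) -> 'I_n}) =>
  ((p j * (if injectiveb s then (n ^_ d j)%:R^-1 else 0))%:E *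
    \int[F j]_xi (f (add_job (k j) s xi w))%:E)%E))/=.
apply: eq_bigr => j _.
transitivity ((p j)%:E * ((n ^_ d j)%:R^-1%:E *
   \sum_(s : {ffun 'I_(d j) -> 'I_n} | injectiveb s)
     \int[F j]_xi (f (add_job (k j) s xi w))%:E))%E.
  rewrite ge0_sume_distrr; last by move=> s _; exact: Fint_ge0.
  rewrite ge0_sume_distrr; last first.
    by move=> s _; rewrite mule_ge0 ?lee_fin ?invr_ge0// Fint_ge0.
  rewrite [RHS]big_mkcond/=; apply: eq_bigr => s _.
  by case: ifP => _; rewrite ?mulr0 ?mul0e// EFinM muleA.
congr (_ * _)%E.
have msum : measurable_fun setT (fun xi =>
    (\sum_(s : {ffun 'I_(d j) -> 'I_n} | injectiveb s) f (add_job (k j) s xi w))%:E).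
  under eq_fun do rewrite big_mkcond/=.
  apply/measurable_EFinP; apply: measurable_sum => s; case: (injectiveb s) => //.
  by apply/measurable_EFinP; exact: mfa.
rewrite [RHS](eq_integral (fun xi => ((n ^_ d j)%:R^-1%:E *
    (\sum_(s : {ffun 'I_(d j) -> 'I_n} | injectiveb s)
      f (add_job (k j) s xi w))%:E)%E)); last by move=> xi _; rewrite -EFinM.
rewrite ge0_integralZl ?lee_fin ?invr_ge0//; last first.
  by move=> xi _; rewrite lee_fin sumr_ge0.
congr (_ * _)%E; rewrite -big_filter -ge0_integral_sum//; last 2 first.
  by move=> s; exact: mfa.
  by move=> s xi _; rewrite lee_fin.
by apply: eq_integral => xi _; rewrite big_filter sumEFin.
Qed.

(** The value of [Phi1] on the centred occupancy of [w], by [Phi1_occupancy]. *)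
Let N w : R := n%:R^-1 *
  \sum_i `|Num.max 0 (tnth w i) - mean (fun i => Num.max 0 (tnth w i))|.

Let rate := class_rate (d j0) e g.

Let V w := sqdev (tnth w).
Let mV : measurable_fun setT V.
Proof. by apply: measurable_sqdev => i; exact: measurable_tnth. Qed.
Let V0 w : 0 <= V w. Proof. exact: sqdev_ge0. Qed.

Let mxi2 j : measurable_fun setT (fun xi : (d j).-tuple R => \sum_a tnth xi a ^+ 2).
Proof.
apply: measurable_sum => a; apply: measurable_funX; exact: measurable_tnth.
Qed.

Let int_bound j w : (\int[F j]_xi (V w + \sum_a tnth xi a ^+ 2)%:E = (V w + S j)%:E)%E.
Proof.
under eq_integral do rewrite EFinD.
rewrite ge0_integralD//; last 3 first.
- by move=> xi _; rewrite lee_fin.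
- by move=> xi _; rewrite lee_fin sumr_ge0// => a _; exact: sqr_ge0.
- by apply/measurable_EFinP; exact: mxi2.
by rewrite probability_integral_cst SE.
Qed.

Let xi2_ge0 j (xi : (d j).-tuple R) : 0 <= \sum_a tnth xi a ^+ 2.
Proof. by apply: sumr_ge0 => a _; exact: sqr_ge0. Qed.

Let mVxi j w : measurable_fun setT
  (fun xi : (d j).-tuple R => (V w + \sum_a tnth xi a ^+ 2)%:E).
Proof. by apply/measurable_EFinP; apply: measurable_funD => //; exact: mxi2. Qed.

Lemma avg_drift j w :
  (\int[F j]_xi (avg_after (k j) xi w V)%:E <= (V w + S j)%:E)%E.
Proof.
rewrite -int_bound; apply: ae_ge0_le_integral => //.
- by move=> xi _; rewrite lee_fin avg_after_ge0.
- by apply/measurable_EFinP; exact: measurable_avg_after.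
- by move=> xi _; rewrite lee_fin addr_ge0.
- exact: mVxi.
apply: (negligibleS _ (negligible_negative (F_nonneg j))) => xi nh xi0.
apply: nh => _ /=; rewrite lee_fin.
exact: avg_after_sqdev.
Qed.

(** [mad_pair] is applied at the positive part of [m], because taking positive parts is
    1-Lipschitz. *)
Let mad_le w m : n%:R * N w <= 2 * \sum_i `|tnth w i - m|.
Proof.
rewrite /N mulVKf; last by rewrite pnatr_eq0 -lt0n.
apply: (le_trans (mad_pair _ (Num.max 0 m) n0)); rewrite ler_wpM2l//.
apply: ler_sum => i _; rewrite ler_norml.
have := ler_norm (tnth w i - m); have := ler_norm (- (tnth w i - m)); rewrite normrN.
move: `|_| => M h1 h2; rewrite /Num.max.
by case: ifPn; case: ifPn; rewrite -?leNgt => h3 h4; apply/andP; split; lra.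
Qed.

Let dj0 : 0 < (d j0)%:R :> R.
Proof. by have /andP[k0 kd] := k_d j0; rewrite ltr0n (leq_trans k0). Qed.

(** Integration of [avg_after_sqdev_strict] at a median, each of the two events having probability
    at least [g]. The gains stand on the left so that all integrands are nonnegative. *)
Lemma avg_drift_strict w :
  (\int[F j0]_xi (avg_after (k j0) xi w V)%:E +
    (rate * (N w - 2 * D))%:E <= (V w + S j0)%:E)%E.
Proof.
have [m [m_ge m_le]] := median_ex (tnth w) n0.
pose c1 := e / (4%:R ^+ d j0 * (2 * (d j0)%:R * n%:R)).
have nR : 0 < n%:R :> R by rewrite ltr0n.
have c10 : 0 <= c1 by rewrite divr_ge0 ?mulr_ge0 ?exprn_ge0// ltW.
pose G1 := [set xi : (d j0).-tuple R | spread_sizes (k j0) xi D e].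
pose G2 := [set xi : (d j0).-tuple R | large_sizes (k j0) xi D e].
have mG1 : measurable G1.
  rewrite -[X in measurable X]setTI.
  exact: (@measurable_spread_sizes _ _ _ (k_d j0) D e measurableT [set true]).
have mG2 : measurable G2.
  rewrite -[X in measurable X]setTI.
  exact: (@measurable_large_sizes _ _ _ (k_d j0) D e measurableT [set true]).
pose lo := low_dev w m D; pose hi := high_dev w m D.
have lo0 : 0 <= lo by apply: sumr_ge0 => i h; have := D0; lra.
have hi0 : 0 <= hi by apply: sumr_ge0 => i h; have := D0; lra.
have cl0 : 0 <= c1 * lo := mulr_ge0 c10 lo0.
have ch0 : 0 <= c1 * hi := mulr_ge0 c10 hi0.
have mI A : measurable A ->
    measurable_fun setT (fun xi : (d j0).-tuple R => (\1_A xi : R)%:E).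
  by move=> mA; apply/measurable_EFinP; exact: measurable_indic.
have i1 : ((c1 * lo * g)%:E <= \int[F j0]_xi ((c1 * lo)%:E * (\1_G1 xi)%:E))%E.
  rewrite ge0_integralZl; last 4 first.
  - exact: measurableT.
  - exact: mI.
  - by move=> xi _; rewrite lee_fin.
  - by rewrite lee_fin.
  by rewrite integral_indic// setIT EFinM; apply: lee_pmul; rewrite // lee_fin ltW.
have i2 : ((c1 * hi * g)%:E <= \int[F j0]_xi ((c1 * hi)%:E * (\1_G2 xi)%:E))%E.
  rewrite ge0_integralZl; last 4 first.
  - exact: measurableT.
  - exact: mI.
  - by move=> xi _; rewrite lee_fin.
  - by rewrite lee_fin.
  by rewrite integral_indic// setIT EFinM; apply: lee_pmul; rewrite // lee_fin ltW.
have ma : measurable_fun setT (fun xi : (d j0).-tuple R => (avg_after (k j0) xi w V)%:E).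
  by apply/measurable_EFinP; exact: measurable_avg_after.
have m1 : measurable_fun setT
    (fun xi : (d j0).-tuple R => (c1 * lo)%:E * (\1_G1 xi)%:E)%E.
  by apply: measurable_funeM; exact: mI.
have m2 : measurable_fun setT
    (fun xi : (d j0).-tuple R => (c1 * hi)%:E * (\1_G2 xi)%:E)%E.
  by apply: measurable_funeM; exact: mI.
have t1 xi : (0 <= (c1 * lo)%:E * (\1_G1 xi)%:E)%E.
  by apply: mule_ge0; rewrite lee_fin.
have t2 xi : (0 <= (c1 * hi)%:E * (\1_G2 xi)%:E)%E.
  by apply: mule_ge0; rewrite lee_fin.
have t0 (xi : (d j0).-tuple R) : (0 <= (avg_after (k j0) xi w V)%:E)%E.
  by rewrite lee_fin avg_after_ge0.
apply: (@le_trans _ _ (\int[F j0]_xi ((avg_after (k j0) xi w V)%:E +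
   ((c1 * lo)%:E * (\1_G1 xi)%:E + (c1 * hi)%:E * (\1_G2 xi)%:E)))%E).
  rewrite ge0_integralD; last 5 first.
  - exact: measurableT.
  - by [].
  - exact: ma.
  - by move=> xi _; rewrite adde_ge0.
  - exact: emeasurable_funD.
  rewrite leeD2l// ge0_integralD; last 5 first.
  - exact: measurableT.
  - by [].
  - exact: m1.
  - by [].
  - exact: m2.
  apply: le_trans (leeD i1 i2); rewrite -EFinD lee_fin -mulrDl -mulrDr.
  have h := low_high_dev w m D0; rewrite -/lo -/hi in h.
  have h' := mad_le w m.
  (* Half of the mean deviation is controlled by the deviation from the median, of which at most [D]
     per server is lost. *)
  apply: (@le_trans _ _ (c1 * (n%:R * (N w / 2 - D)) * g)).
    rewrite le_eqVlt; apply/orP; left; apply/eqP; rewrite /rate /class_rate /c1.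
    by field; rewrite !gt_eqF ?exprn_gt0.
  by rewrite ler_wpM2r ?(ltW g0)// ler_wpM2l//; lra.
rewrite -int_bound; apply: ae_ge0_le_integral => //.
- by move=> xi _; rewrite !adde_ge0.
- by apply: emeasurable_funD => //; exact: emeasurable_funD.
- by move=> xi _; rewrite lee_fin addr_ge0.
- exact: mVxi.
apply: (negligibleS _ (negligible_negative (F_nonneg j0))) => xi nh xi0.
apply: nh => _ /=.
rewrite -!EFinM -!EFinD lee_fin.
have := avg_after_sqdev_strict (k_d j0) (d_n j0) xi0 D0 (ltW e0) m_ge m_le kd0.
rewrite -/lo -/hi -/c1 -/V !indicE.
have -> : (xi \in G1) = spread_sizes (k j0) xi D e by apply/idP/idP; rewrite inE.
have -> : (xi \in G2) = large_sizes (k j0) xi D e by apply/idP/idP; rewrite inE.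
move: (spread_sizes _ _ _ _) (large_sizes _ _ _ _) => b1 b2 h.
by rewrite -lerBrDr; apply: (le_trans h); rewrite lerD2l lerN2; lra.
Qed.

Let S0 j : 0 <= S j.
Proof. by rewrite -lee_fin -SE; exact: Fint_ge0. Qed.

Let p_le1 j : p j <= 1.
Proof. by rewrite -p1 (bigD1 j)//= lerDl sumr_ge0. Qed.

Let N_ge0 w : 0 <= N w.
Proof. by rewrite mulr_ge0 ?invr_ge0// sumr_ge0. Qed.

Variable K : R.
Hypothesis K0 : 0 <= K.

Let avg_trunc_le j w (xi : (d j).-tuple R) :
  avg_after (k j) xi w (trunc_sqdev K) <= K /\
  avg_after (k j) xi w (trunc_sqdev K) <= avg_after (k j) xi w V.
Proof.
have nd0 : 0 < (n ^_ d j)%:R :> R.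
  by rewrite ltr0n ffact_gt0 (leq_trans _ (d_n j))// leq_pmull.
split; last first.
  rewrite /avg_after ler_wpM2l ?invr_ge0//; apply: ler_sum => s _.
  by rewrite ge_min lexx.
rewrite /avg_after ler_pdivrMl// -card_inj mulr_natl -sumr_const.
by apply: ler_sum => s _; exact: trunc_sqdev_le.
Qed.

Let mtrunc : measurable_fun setT (@trunc_sqdev R n K).
Proof. exact: measurable_trunc_sqdev. Qed.

Let trunc0 w : 0 <= trunc_sqdev K w.
Proof. exact: trunc_sqdev_ge0. Qed.

Let I j w := (\int[F j]_xi (avg_after (k j) xi w (trunc_sqdev K))%:E)%E.

Let mavgE (f : n.-tuple R -> R) j w : measurable_fun setT f ->
  measurable_fun setT (fun xi : (d j).-tuple R => (avg_after (k j) xi w f)%:E).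
Proof. by move=> mf; apply/measurable_EFinP; exact: measurable_avg_after. Qed.

Let I_leV j w : (I j w <= \int[F j]_xi (avg_after (k j) xi w V)%:E)%E.
Proof.
apply: ge0_le_integral => //.
- by move=> xi _; rewrite lee_fin avg_after_ge0.
- exact: mavgE.
- exact: mavgE.
- by move=> xi _; rewrite lee_fin; case: (avg_trunc_le w xi).
Qed.

Let I_leK j w : (I j w <= K%:E)%E.
Proof.
rewrite -(probability_integral_cst (F j) K); apply: ge0_le_integral => //.
- by move=> xi _; rewrite lee_fin avg_after_ge0.
- exact: mavgE.
- by move=> xi _; rewrite lee_fin; case: (avg_trunc_le w xi).
Qed.

Let I_ge0 j w : (0 <= I j w)%E.
Proof. by apply: Fint_ge0 => xi; exact: avg_after_ge0. Qed.

(** Truncation bounds the integral by [K], so the averages over classes can be computed in [R]. *)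
Let IE j w : I j w = (fine (I j w))%:E.
Proof. by rewrite fineK// ge0_fin_numE// (le_lt_trans (I_leK _ _)) ?ltry. Qed.

Let mean_after_truncE w : mean_after k F p (trunc_sqdev K) w =
  (\sum_j p j * fine (I j w))%:E.
Proof.
rewrite mean_afterE// -sumEFin; apply: eq_bigr => j _.
by rewrite -/(I j w) IE EFinM.
Qed.

Lemma mean_after_le w : (mean_after k F p (trunc_sqdev K) w <= K%:E)%E.
Proof.
rewrite mean_after_truncE lee_fin -[K]mul1r -p1 mulr_suml.
by apply: ler_sum => j _; rewrite ler_wpM2l// -lee_fin -IE.
Qed.

(** Class [j0] supplies the decrease, with weight at least [q]; every class [j] raises the mean by
    at most [S j]. *)
Lemma mean_after_drift w :
  (mean_after k F p (trunc_sqdev K) w + (q * rate * N w)%:E <=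
    (V w + (\sum_j S j + 2 * D * rate))%:E)%E.
Proof.
rewrite mean_after_truncE -EFinD lee_fin.
have r0 : 0 <= rate.
  by apply/ltW/class_rate_gt0; rewrite // -(ltr0n R).
have h j : fine (I j w) <= V w + S j.
  by rewrite -lee_fin -IE; exact: le_trans (I_leV j w) (avg_drift j w).
have h0 : fine (I j0 w) + rate * (N w - 2 * D) <= V w + S j0.
  rewrite -lee_fin EFinD -IE; apply: le_trans (avg_drift_strict w).
  by rewrite leeD2r.
rewrite (bigD1 j0)//=.
have h1 : \sum_(j | j != j0) p j * fine (I j w) <= \sum_(j | j != j0) p j * (V w + S j).
  by apply: ler_sum => j _; rewrite ler_wpM2l.
have h2 := ler_wpM2l (p0 j0) h0.
have h3 : \sum_j p j * (V w + S j) <= V w + \sum_j S j.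
  under eq_bigr do rewrite mulrDr.
  rewrite big_split/= -mulr_suml p1 mul1r lerD2l; apply: ler_sum => j _.
  by rewrite ler_piMl.
rewrite (bigD1 j0)//= in h3.
(* The weight [p j0] is bounded below by [q] in the gain and above by 1 in the loss. *)
have h4 : q * rate * N w <= p j0 * rate * N w.
  by rewrite ler_wpM2r// ler_wpM2r.
have h5 : p j0 * rate * (2 * D) <= 1 * rate * (2 * D).
  by rewrite ler_wpM2r ?mulr_ge0// ler_wpM2r.
lra.
Qed.

End mean_drift.

(** * Removal of the truncation and the uniform bound *)

(* [V] need not be integrable, so that only its truncations can be compared. *)
Lemma integral_drift_le (R : realType) dT (T : measurableType dT)
    (mu : probability T R) (V h : T -> R) (M : nat -> T -> \bar R) (b : R) :
  measurable_fun setT V -> measurable_fun setT h ->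
  (forall K, measurable_fun setT (M K)) ->
  (forall w, 0 <= V w) -> (forall w, 0 <= h w) -> 0 <= b ->
  (forall K w, 0 <= M K w)%E ->
  (forall K, \int[mu]_w (Num.min (V w) K%:R)%:E <= \int[mu]_w M K w)%E ->
  (forall K w, M K w <= K%:R%:E)%E ->
  (forall K w, M K w + (h w)%:E <= (V w + b)%:E)%E ->
  (\int[mu]_w (h w)%:E <= b%:E)%E.
Proof.
move=> mV mh mM V0 h0 b0 M0 VM MK Mh.
(* Where [V + b <= K] the truncation is inactive and the drift bound applies in full. Elsewhere [h]
   is dropped, and [M K] is at most both [V + b] and [K]. *)
pose g (K : nat) w : R := if V w + b <= K%:R then h w else 0.
have g0 K w : (0 <= (g K w)%:E)%E by rewrite lee_fin /g; case: ifP.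
have mg K : measurable_fun setT (fun w => (g K w)%:E).
  apply/measurable_EFinP; apply: measurable_fun_ifT => //.
  by apply: measurable_fun_ler => //; exact: measurable_funD.
have mVK K : measurable_fun setT (fun w => (Num.min (V w) K%:R)%:E).
  by apply/measurable_EFinP; exact: measurable_minr.
have VK0 K w : (0 <= (Num.min (V w) K%:R)%:E)%E.
  by rewrite lee_fin le_min V0/=.
have gb K : (\int[mu]_w (g K w)%:E <= b%:E)%E.
  have : (\int[mu]_w (M K w + (g K w)%:E) <=
          \int[mu]_w ((Num.min (V w) K%:R)%:E + b%:E))%E.
    apply: ge0_le_integral => //.
    - by move=> w _; rewrite adde_ge0.
    - exact: emeasurable_funD.
    - exact: emeasurable_funD.
    move=> w _; rewrite /g; case: ifPn => [Vb|Vb].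
      rewrite (_ : Num.min _ _ = V w); first exact: Mh.
      by apply/min_idPl; rewrite (le_trans _ Vb)// lerDl.
    rewrite adde0 -EFinD addr_minl.
    have [_|_] := leP (V w + b) (K%:R + b).
      apply: le_trans (Mh K w); rewrite -[leLHS]adde0 leeD2l//.
      by rewrite lee_fin.
    by apply: (le_trans (MK K w)); rewrite lee_fin lerDl.
  rewrite !ge0_integralD// probability_integral_cst => h1.
  (* The truncated mean is finite and at most the mean of [M K], so it cancels and leaves the bound
     on [g K]. *)
  have VKfin : (\int[mu]_w (Num.min (V w) K%:R)%:E \is a fin_num)%E.
    rewrite ge0_fin_numE; last exact: integral_ge0.
    apply: (@le_lt_trans _ _ K%:R%:E); last exact: ltry.
    rewrite -(probability_integral_cst mu K%:R); apply: ge0_le_integral => //.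
    by move=> w _; rewrite lee_fin ge_min lexx orbT.
  rewrite -(leeD2lE _ _ VKfin); apply: le_trans h1.
  by rewrite leeD2r.
(* For each state [g K] equals [h] from some [K] on; monotone convergence transfers the bound. *)
have -> : (\int[mu]_w (h w)%:E = \int[mu]_w limn (fun K => (g K w)%:E))%E.
  apply: eq_integral => w _; apply/esym/cvg_lim => //.
  apply: cvg_near_cst; exists (Num.trunc (V w + b)).+1 => // K /= hK.
  rewrite /g ifT//; apply: (le_trans (ltW (truncnS_gt _))).
  by rewrite ler_nat.
rewrite monotone_convergence//; last first.
  move=> w _ K K' KK'; rewrite lee_fin /g; case: ifPn => [h1|_]; last by case: ifP.
  by rewrite ifT// (le_trans h1)// ler_nat.
apply: lime_le; last by apply: nearW => K; exact: gb.
apply: ereal_nondecreasing_is_cvgn => K K' KK'; apply: ge0_le_integral => //.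
move=> w _; rewrite lee_fin /g; case: ifPn => [h1|_]; last by case: ifP.
by rewrite ifT// (le_trans h1)// ler_nat.
Qed.

Local Open Scope ereal_scope.

Theorem theorem5p2 (R : realType) (J : finType) (k d : J -> nat)
    (F : forall j, probability ((d j).-tuple R) R)
    (pin : nat -> J -> R) (p : J -> R)
    (k_d : forall j, (1 <= k j <= d j)%N)
    (F_nonneg : forall j, F j [set xi | nonneg xi] = 1)
    (F_exchangeable : forall j, exchangeable (F j))
    (pin_ge0 : forall n j, (0 <= pin n j)%R)
    (pin_sum1 : forall n, (\sum_j pin n j)%R = 1%R)
    (pin_cvg : forall j, pin n j @[n --> \oo] --> p j)
    (mean_pos_fin : forall j, 0 < \int[F j]_xi (xi`_0)%:E < +oo)
    (some_work : exists j, F j [set xi : (d j).-tuple R | (k j <= count_mem 0%R xi)%N] < 1)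
    (second_moment : forall j, \int[F j]_xi ((xi`_0) ^+ 2)%:E < +oo)
    (nontrivial : exists j,
       [/\ (0 < p j)%R, (k j < d j)%N,
           0 < F j [set xi | (0 < \big[Num.max/0]_(a < d j) tnth xi a
                                  - kth_smallest (k j) xi)%R]
         & F j [set xi : (d j).-tuple R | (k j <= count_mem 0%R xi)%N] < 1]) :
  exists (C : R) (nbar : nat), (0 < C)%R /\
    forall (n : nat) (lambda : R), (nbar <= n)%N -> (0 < lambda)%R ->
    forall (dO : measure_display) (O : measurableType dO)
      (P : probability O R)
      (D : arrivals (n := n) F (lambda * n%:R) (pin n) P),
      stable k D ->
    forall mu : probability (n.-tuple R) R, stationary k D mu ->
      \int[mu]_w Phi1 (centered (occupancy w)) <= C%:E.
Proof.
have [j0 [pj0 kd0 spread_pos zero_lt1]] := nontrivial.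
have [N1 spreadN] := spread_sizes_pos (k_d j0) (F_nonneg j0) spread_pos.
have [N2 largeN] := large_sizes_pos (k_d j0) (F_nonneg j0) zero_lt1.
(* Positivity of both probabilities persists for larger [N], so one [N] gives a common size bound
   [D0] and margin [e]. *)
pose N := maxn N1 N2.
have {}spread_pos := spreadN N (leq_maxl _ _).
have large_pos := largeN N (leq_maxr _ _).
pose D0 : R := N%:R; pose e : R := (N.+1%:R^-1)%R.
pose A := [set xi : (d j0).-tuple R | spread_sizes (k j0) xi D0 e].
pose B := [set xi : (d j0).-tuple R | large_sizes (k j0) xi D0 e].
have mA : measurable A.
  rewrite -[X in measurable X]setTI.
  exact: (@measurable_spread_sizes _ _ _ (k_d j0) D0 e measurableT [set true]).
have mB : measurable B.
  rewrite -[X in measurable X]setTI.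
  exact: (@measurable_large_sizes _ _ _ (k_d j0) D0 e measurableT [set true]).
have FA : F j0 A = (fine (F j0 A))%:E by rewrite fineK// fin_num_measure.
have FB : F j0 B = (fine (F j0 B))%:E by rewrite fineK// fin_num_measure.
pose g : R := Num.min (fine (F j0 A)) (fine (F j0 B)).
have g0 : (0 < g)%R by rewrite lt_min -!lte_fin -FA -FB spread_pos.
have gA : g%:E <= F j0 A by rewrite FA lee_fin ge_min lexx.
have gB : g%:E <= F j0 B by rewrite FB lee_fin ge_min lexx orbT.
pose S j : R := fine (\int[F j]_xi (\sum_a tnth xi a ^+ 2)%:E).
have SE j : \int[F j]_xi (\sum_a tnth xi a ^+ 2)%:E = (S j)%:E.
  rewrite fineK// ge0_fin_numE; first exact: second_moment_sum.
  apply: integral_ge0 => xi _; rewrite lee_fin sumr_ge0// => a _.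
  exact: sqr_ge0.
have e0 : (0 < e)%R by rewrite invr_gt0.
have D00 : (0 <= D0)%R by [].
(* Half of the limit [p j0] is a lower bound for [pin n j0] once [n] is large. *)
pose q : R := (p j0 / 2)%R.
have q0 : (0 < q)%R by rewrite divr_gt0.
have [N0 _ pinq] : \forall n \near \oo, (q < pin n j0)%R.
  by apply: (cvgr_gt _ (pin_cvg j0)); rewrite /q; lra.
pose r : R := class_rate (d j0) e g.
have dj0 : (0 < d j0)%N by have /andP[] := k_d j0; exact: leq_trans.
have r0 : (0 < r)%R by exact: class_rate_gt0.
pose b : R := (\sum_j S j + 2 * D0 * r)%R.
have S0 j : (0 <= S j)%R.
  rewrite -lee_fin -SE; apply: integral_ge0 => xi _.
  by rewrite lee_fin sumr_ge0// => a _; exact: sqr_ge0.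
have b0 : (0 <= b)%R by rewrite addr_ge0 ?sumr_ge0// !mulr_ge0// ltW.
(* The [+ 1] gives [0 < C], only [0 <= b] being known. The sum of the [4 * d j] dominates each of
   them, and [N0] ensures [q < pin n j0]. *)
exists (b / (q * r) + 1)%R, (maxn N0 (\sum_j 4 * d j)); split.
  by rewrite ltr_wpDl// divr_ge0// mulr_ge0// ltW.
move=> n lambda; rewrite geq_max => /andP[n_N0 n_d] lambda0 dO O P D _ mu mu_st.
have d_n j : (4 * d j <= n)%N.
  by apply: leq_trans n_d; rewrite (bigD1 j)//= leq_addr.
have n0 : (0 < n)%N by apply: leq_trans (d_n j0); rewrite muln_gt0.
have d_n' j : (d j <= n)%N by apply: leq_trans (d_n j); rewrite leq_pmull.
have rate0 : (0 < lambda * n%:R)%R by rewrite mulr_gt0// ltr0n.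
have pq : (q <= pin n j0)%R by rewrite ltW// pinq.
pose mad (w : n.-tuple R) : R := (n%:R^-1 *
  \sum_i `|Num.max 0 (tnth w i) - mean (fun i => Num.max 0 (tnth w i))|)%R.
under eq_integral do rewrite Phi1_occupancy//.
have mad0 w : (0 <= mad w)%R by rewrite mulr_ge0 ?invr_ge0 ?sumr_ge0.
have mmax i : measurable_fun setT (fun w : n.-tuple R => Num.max 0%R (tnth w i)).
  by apply: measurable_maxr => //; exact: measurable_tnth.
have mmad : measurable_fun setT mad.
  apply: measurable_funM => //; apply: measurable_sum => i.
  apply: measurableT_comp => //; apply: measurable_funB => //.
  exact: measurable_mean.
have qr0 : (0 < q * r)%R by rewrite mulr_gt0.
have H : \int[mu]_w (q * r * mad w)%:E <= b%:E.
  (* Here [h] is [q * r] times the mean deviation and [M K] the mean, after one more job, of the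
     squared deviations truncated at [K]; neither the bound [b] nor [q * r] involves [n] or
     [lambda]. *)
  apply: (@integral_drift_le _ _ _ mu (fun w => sqdev (tnth w)) _
    (fun K => mean_after k F (pin n) (trunc_sqdev K%:R))).
  - by apply: measurable_sqdev => i; exact: measurable_tnth.
  - exact: measurable_funM.
  - move=> K; apply: measurable_mean_after => //.
      exact: measurable_trunc_sqdev.
    by move=> w; exact: trunc_sqdev_ge0.
  - by move=> w; exact: sqdev_ge0.
  - by move=> w; rewrite mulr_ge0// ltW.
  - by [].
  - by move=> K w; apply: mean_after_ge0 => // w'; exact: trunc_sqdev_ge0.
  - move=> K; apply: (@stationary_le _ _ k d F n _ (pin n) _ _ P D k_d
      (pin_ge0 n) (pin_sum1 n) d_n' rate0 mu mu_st (trunc_sqdev K%:R) K%:R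
      (K%:R + 2 * n%:R)%R).
    + exact: measurable_trunc_sqdev.
    + by move=> w; exact: trunc_sqdev_ge0.
    + by move=> w; exact: trunc_sqdev_le.
    + by rewrite addr_ge0// mulr_ge0.
    + by move=> w t t0; exact: trunc_sqdev_drain.
    + by move=> w t j s xi w0 t0; exact: trunc_sqdev_add_job.
  - by move=> K w; apply: mean_after_le.
  - move=> K w; exact: (mean_after_drift k_d F_nonneg SE kd0 D00 e0 g0 gA gB
      d_n (pin_ge0 n) (pin_sum1 n) pq (ler0n R K) w).
have Hm : \int[mu]_w (mad w)%:E = (q * r)^-1%:E * \int[mu]_w (q * r * mad w)%:E.
  rewrite -ge0_integralZl_EFin//; last 3 first.
  - by move=> w _; rewrite lee_fin mulr_ge0// ltW.
  - by apply/measurable_EFinP; exact: measurable_funM.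
  - by rewrite invr_ge0 ltW.
  by apply: eq_integral => w _; rewrite -EFinM mulKf// gt_eqF.
rewrite Hm; apply: (@le_trans _ _ ((q * r)^-1%:E * b%:E)).
  by rewrite lee_pmul2l// lte_fin invr_gt0.
by rewrite -EFinM lee_fin mulrC lerDl.
Qed.
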